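(* Let $0<r<1$, $\alpha>0$ and $\beta\in\mathbb{R}$. Then for every integer $n\geq n_1(\alpha,r)$ there is a real number $\gamma_{n,\infty}^{(2)}=\gamma_{n,\infty}^{(2)}(\alpha,r,\beta)$ with $|\gamma_{n,\infty}^{(2)}|\leq20\pi^{4}$ such that $$ {\cal E}_{n}(C^{\alpha,r}_{\beta,\infty})_{C}=\frac{4}{\pi^{2}}e^{-\alpha n^{r}}\ln\Big(\frac{\pi n^{1-r}}{\alpha r}\Big)+\gamma_{n,\infty}^{(2)}e^{-\alpha n^{r}}. $$
   Context: $L_\infty$ is the space of measurable essentially bounded $2\pi$-periodic functions with $\|f\|_\infty=\operatorname{ess\,sup}_t|f(t)|$; $C$ is the space of continuous $2\pi$-periodic functions with $\|f\|_C=\max_t|f(t)|$. Generalized Poisson kernel: $P_{\alpha,r,\beta}(t)=\sum_{k=1}^{\infty}e^{-\alpha k^{r}}\cos\big(kt-\frac{\beta\pi}{2}\big)$. $B_\infty^0=\{\varphi\in L_\infty:\ \|\varphi\|_\infty\le 1,\ \int_{-\pi}^{\pi}\varphi(t)\,dt=0\}$ (real-valued functions). $C^{\alpha,r}_{\beta,\infty}$ is the set of all $2\pi$-periodic functions $f$ representable for all $x\in\mathbb{R}$ as $f(x)=\frac{a_0}{2}+\frac1\pi\int_{-\pi}^{\pi}P_{\alpha,r,\beta}(x-t)\varphi(t)\,dt$ with $a_0\in\mathbb{R}$ and $\varphi\in B_\infty^0$. ${\cal E}_{n}(C^{\alpha,r}_{\beta,\infty})_{C}=\sup_{f\in C^{\alpha,r}_{\beta,\infty}}\|f(\cdot)-S_{n-1}(f;\cdot)\|_{C}$,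 where $S_{n-1}(f;\cdot)$ is the partial Fourier sum of order $n-1$ of $f$ (harmonics of degree $0,\dots,n-1$). $n_1=n_1(\alpha,r)$ is the smallest positive integer $n$ such that $$ \frac{1}{\alpha r}\frac{1}{n^{r}}\Big(1+\ln\Big(\frac{\pi n^{1-r}}{\alpha r}\Big)\Big)+\frac{\alpha r }{n^{1-r}}\leq \frac{1}{(3\pi)^3}. $$ *)

(* Defs.v *)
From mathcomp Require Import all_boot all_order all_algebra.
From mathcomp Require Import all_classical all_reals all_analysis.
From mathcomp Require Import ess_sup_inf.
From mathcomp Require Import ring lra.

Set Implicit Arguments.
Unset Strict Implicit.
Unset Printing Implicit Defensive.

Import Order.TTheory GRing.Theory Num.Theory.
Import numFieldNormedType.Exports.

Local Open Scope classical_set_scope.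
Local Open Scope ring_scope.

Section Defs.
Context {R : realType}.
Implicit Types (alpha r beta : R) (f phi : R -> R).

(* For alpha, r > 0 the series converges absolutely, so [lim] is its sum. *)
Definition poisson_kernel alpha r beta (t : R) : R :=
  limn (series (fun j : nat => let k : R := j.+1%:R in
    expR (- alpha * k `^ r) * cos (k * t - beta * pi / 2))).

(* Measurability is Borel measurability: every class of L_oo has a 2pi-periodic
   Borel representative, and only integrals of phi are used.
   By periodicity the essential supremum may be taken over the whole line. *)
Definition Linfty_2pi phi : Prop :=
  [/\ measurable_fun setT phi, periodic phi (pi *+ 2) &
      (ess_sup lebesgue_measure (fun t : R => `|phi t|%:E) < +oo)%E].

Definition B0infty : set (R -> R) :=
  [set phi | [/\ Linfty_2pi phi,
    (ess_sup lebesgue_measure (fun t : R => `|phi t|%:E) <= 1)%E &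
    \int[lebesgue_measure]_(t in `[- pi, pi]) phi t = 0]].

Definition poisson_class alpha r beta : set (R -> R) :=
  [set f | periodic f (pi *+ 2) /\
    exists a0 : R, exists2 phi, B0infty phi & forall x,
      f x = a0 / 2 + pi^-1 * \int[lebesgue_measure]_(t in `[- pi, pi])
                               (poisson_kernel alpha r beta (x - t) * phi t)].

Definition fourier_cos f (k : nat) : R :=
  pi^-1 * \int[lebesgue_measure]_(t in `[- pi, pi]) (f t * cos (k%:R * t)).

Definition fourier_sin f (k : nat) : R :=
  pi^-1 * \int[lebesgue_measure]_(t in `[- pi, pi]) (f t * sin (k%:R * t)).

Definition fourier_sum f (m : nat) (x : R) : R :=
  fourier_cos f 0 / 2 +
  \sum_(1 <= k < m.+1)
     (fourier_cos f k * cos (k%:R * x) + fourier_sin f k * sin (k%:R * x)).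

(* The supremum is attained for continuous periodic f; it is extended-real so
   that no boundedness is presupposed. *)
Definition normC f : \bar R := ereal_sup [set `|f x|%:E | x in [set: R]].

Definition fourier_deviation alpha r beta (n : nat) : \bar R :=
  ereal_sup [set normC (fun x => f x - fourier_sum f n.-1 x)
            | f in poisson_class alpha r beta].

Definition n1_cond alpha r (n : nat) : bool :=
  1 / (alpha * r) * (1 / n%:R `^ r)
    * (1 + ln (pi * n%:R `^ (1 - r) / (alpha * r)))
  + alpha * r / n%:R `^ (1 - r) <= 1 / (3 * pi) ^+ 3.

Lemma powRV_small (p e : R) : 0 < p -> 0 < e ->
  exists N : nat, forall n, (N <= n)%N -> (0 < n)%N -> (n%:R `^ p)^-1 <= e.
Proof.
move=> p0 e0.
exists (Num.truncn (e^-1 `^ p^-1)).+1 => n Nn n0.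
have pn : 0 < n%:R `^ p :> R by rewrite powR_gt0 ?ltr0n.
rewrite -[leRHS]invrK lef_pV2 ?posrE ?invr_gt0//.
have -> : e^-1 = (e^-1 `^ p^-1) `^ p.
  by rewrite -powRrM mulVf ?gt_eqF// powRr1// invr_ge0 ltW.
apply: ge0_ler_powR; rewrite ?nnegrE ?powR_ge0//; first exact: ltW.
apply: ltW; apply: (lt_le_trans (truncnS_gt _)).
by rewrite ler_nat.
Qed.

Lemma n1_cond_exists alpha r : 0 < alpha -> 0 < r < 1 ->
  exists n : nat, (0 < n)%N && n1_cond alpha r n.
Proof.
move=> alpha0 /andP[r0 r1].
set a := alpha * r; have a0 : 0 < a by rewrite mulr_gt0.
have pi0 : 0 < pi :> R := pi_gt0 R.
set c : R := 1 / (3 * pi) ^+ 3.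
have c0 : 0 < c by rewrite /c divr_gt0 ?exprn_gt0 ?mulr_gt0.
have r1' : 0 < 1 - r by rewrite subr_gt0.
set s := r / (2 * (1 - r)).
have s0 : 0 < s by apply: divr_gt0 => //; apply: mulr_gt0.
set K := a^-1 * s^-1 * (pi / a) `^ s.
have K0 : 0 < K.
  by rewrite /K; apply: mulr_gt0; [apply: mulr_gt0; rewrite invr_gt0|rewrite powR_gt0 ?divr_gt0].
have c3 : 0 < c / 3 by rewrite divr_gt0.
have e1 : 0 < a * (c / 3) by rewrite mulr_gt0.
have e2 : 0 < K^-1 * (c / 3) by rewrite mulr_gt0 ?invr_gt0.
have e3 : 0 < a^-1 * (c / 3) by rewrite mulr_gt0 ?invr_gt0.
have r2 : 0 < r / 2 by rewrite divr_gt0.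
have [N1 H1] := powRV_small r0 e1.
have [N2 H2] := powRV_small r2 e2.
have [N3 H3] := powRV_small r1' e3.
have [n [n0 N1n N2n N3n]] :
    exists n, [/\ (0 < n)%N, (N1 <= n)%N, (N2 <= n)%N & (N3 <= n)%N].
  by exists (maxn 1 (maxn N1 (maxn N2 N3))); rewrite !leq_max !leqnn !orbT.
move: (H1 _ N1n n0) (H2 _ N2n n0) (H3 _ N3n n0) => {}H1 {}H2 {}H3.
exists n; rewrite n0 /= /n1_cond -/a -/c.
have nR0 : 0 < n%:R :> R by rewrite ltr0n.
set y := pi * n%:R `^ (1 - r) / a.
have y0 : 0 < y by rewrite /y divr_gt0 ?mulr_gt0 ?powR_gt0.
have lny : ln y <= s^-1 * ((pi / a) `^ s * n%:R `^ (r / 2)).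
  have ys : y `^ s = (pi / a) `^ s * n%:R `^ (r / 2).
    have -> : y = (pi / a) * n%:R `^ (1 - r) by rewrite /y mulrAC.
    rewrite powRM ?powR_ge0 ?divr_ge0 1?ltW// -powRrM; congr (_ * _ `^ _).
    by rewrite /s; field; rewrite gt_eqF.
  rewrite -ys ler_pdivlMl// -ln_powR; apply/ltW/ln_sublinear.
  exact: powR_gt0.
have nr : n%:R `^ r = n%:R `^ (r / 2) * n%:R `^ (r / 2) :> R.
  by rewrite -powRD ?gt_eqF ?implybT// -splitr.
have q0 : 0 < n%:R `^ (r / 2) :> R by rewrite powR_gt0.
have T1 : a^-1 * (n%:R `^ r)^-1 <= c / 3 by rewrite ler_pdivrMl.
have T2 : K * (n%:R `^ (r / 2))^-1 <= c / 3 by rewrite -ler_pdivlMl.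
have T3 : a * (n%:R `^ (1 - r))^-1 <= c / 3 by rewrite -ler_pdivlMl.
have T4 : a^-1 * (n%:R `^ r)^-1 * ln y <= K * (n%:R `^ (r / 2))^-1.
  apply: (@le_trans _ _ (a^-1 * (n%:R `^ r)^-1 *
    (s^-1 * ((pi / a) `^ s * n%:R `^ (r / 2))))).
    by rewrite ler_wpM2l// mulr_ge0 ?invr_ge0 ?powR_ge0// ltW.
  rewrite nr /K le_eqVlt; apply/orP; left; apply/eqP.
  by field; rewrite !gt_eqF.
rewrite !div1r mulrDr mulr1; lra.
Qed.

Definition n1 alpha r (alpha_gt0 : 0 < alpha) (r01 : 0 < r < 1) : nat :=
  ex_minn (n1_cond_exists alpha_gt0 r01).

End Defs.

(* Main.v *)
Require Import Defs.
From mathcomp Require Import all_boot all_order all_algebra.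
From mathcomp Require Import all_classical all_reals all_analysis.
From mathcomp Require Import ess_sup_inf measurable_realfun ring lra.

(**
The deviation is governed by the tail q(t) = sum_(k >= n) psi(k) cos (kt - b) of
the kernel, with psi(k) = exp (- alpha k^r) and b = beta pi / 2: the remainder
f - S_(n-1) f is the convolution of q with phi over pi.  Put
d = alpha r / n^(1-r), the relative decay rate of psi at n.  Two summations by
parts give
  q(t) = - psi(n) sin ((n - 1/2) t - b) / (2 sin (t/2)) + O(psi(n) d / t^2)
on ]0, pi], and |q| <= 3 psi(n) / d everywhere.  Hence only |t| > d matters, up
to O(psi(n)).  On each period of the sine the weight 1 / (2 sin (t/2)) is nearly
constant, so that replacing |sin| by its mean 2 / pi costs O(psi(n)) in total,
and the integral of |q| over [-pi, pi] is psi(n) (4/pi ln (pi/d) + O(1)).  This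
bounds the deviation from above; it is attained up to O(psi(n)) by the sign of
the sine, restricted to whole periods so that its mean vanishes.
*)

Import Order.TTheory GRing.Theory Num.Theory.
Import numFieldNormedType.Exports.

Local Open Scope classical_set_scope.
Local Open Scope ring_scope.

(** * Antiderivatives *)

Section antiderivative.
Context {R : realType}.
Notation mu := (@lebesgue_measure R).
Implicit Types f g F G H : R -> R.

(** The second summation by parts is forced: after a single one the remainder is only O(psi(n) / t),
    the size of the main term, whereas convexity of psi improves it to O(psi(n) d / t^2), whose
    integral beyond [d] is O(psi(n)). The phase [b] is arbitrary, so the zeros of the sine fall at
    no prescribed place. The periods are therefore counted from an upward zero found within one
    period after [d], and the pieces left over next to [d] and [pi] have to be shown harmless. They
    are, because d n = alpha r n^r is at least 216: the period is small compared with [d]. Integrals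
    over single cells are never formed. Both q and |q| are given antiderivatives, and increments of
    these are estimated by comparing derivatives with an elementary majorant or minorant. The
    reflection t -> -t turns [b] into [- b], so everything is proved on the positive half-line for
    every [b] and used twice. The constants leave room: the remainder coefficient lies between -20
    and 61. *)

Lemma is_derive_continuous F (x l : R) : is_derive x 1 F l -> {for x, continuous F}.
Proof. by move=> [dF _]; apply/differentiable_continuous/derivable1_diffP. Qed.

Lemma continuous_integrable_itv f (a b : R) : continuous f ->
  mu.-integrable `[a, b] (EFin \o f).
Proof.
move=> cf; apply: continuous_compact_integrable; first exact: segment_compact.
exact: continuous_subspaceT.
Qed.

(** Mean value theorem for [G - F]. Increments of antiderivatives stand in for integrals over the
    cells, so this replaces monotonicity of the integral. *)
Lemma le_increment F G f g (a b : R) : a <= b ->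
  (forall x : R, x \in `[a, b] -> is_derive x 1 F (f x)) ->
  (forall x : R, x \in `[a, b] -> is_derive x 1 G (g x)) ->
  (forall x, x \in `]a, b[ -> f x <= g x) ->
  F b - F a <= G b - G a.
Proof.
rewrite le_eqVlt => /predU1P[->|ab] dF dG fg; first by rewrite !subrr.
have cF : {within `[a, b], continuous (G - F)}.
  apply: derivable_within_continuous => x xab.
  by apply: derivableB; [case: (dG _ xab)|case: (dF _ xab)].
have dGF x : x \in `]a, b[ -> is_derive x 1 (G - F) (g x - f x).
  move=> /subset_itv_oo_cc xab.
  by apply: is_deriveB; [exact: dG|exact: dF].
have [c cab] := MVT ab dGF cF.
rewrite -subr_ge0.
have -> : (G - F) b - (G - F) a = G b - G a - (F b - F a) by rewrite !fctE; lra.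
by move=> ->; rewrite mulr_ge0 ?subr_ge0 ?fg// ltW.
Qed.

Lemma Rintegral_increment F f (a b : R) : a <= b -> continuous f ->
  (forall x : R, is_derive x 1 F (f x)) -> \int[mu]_(x in `[a, b]) f x = F b - F a.
Proof.
move=> + cf dF; rewrite le_eqVlt => /predU1P[->|ab].
  by rewrite set_itv1 Rintegral_set1 subrr.
rewrite /Rintegral (@continuous_FTC2 _ f F)//.
- exact: continuous_subspaceT.
- split.
  + by move=> x _; case: (dF x).
  + by apply: cvg_at_right_filter; apply: is_derive_continuous (dF a).
  + by apply: cvg_at_left_filter; apply: is_derive_continuous (dF b).
- by move=> x _; rewrite derive1E; case: (dF x).
Qed.

Lemma Rintegral_chasles f (a b c : R) : a <= b -> b <= c -> continuous f ->
  \int[mu]_(x in `[a, c]) f x =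
  \int[mu]_(x in `[a, b]) f x + \int[mu]_(x in `[b, c]) f x.
Proof.
move=> ab bc cf; have /= := @Rintegral_itvB _ f (BLeft a) (BRight c) b.
rewrite Rintegral_itv_obnd_cbnd; last first.
  apply: integrableS (continuous_integrable_itv f b c cf) => //.
  by apply: subset_itv; rewrite bnd_simp.
move=> <-//; [by rewrite addrC subrK|exact: continuous_integrable_itv].
Qed.

(** The fundamental theorem differentiates an integral only to the right of a fixed base point.
    Normalised to vanish at 0, [I B y] does not depend on the base [- B] as long as [- B <= y], so
    the base may move with [y], and one formula serves the whole line. *)
Lemma exists_antiderivative f : continuous f ->
  exists F : R -> R, forall x : R, is_derive x 1 F (f x).
Proof.
move=> cf.
pose I (B y : R) := \int[mu]_(t in `[- B, y]) f t - \int[mu]_(t in `[- B, 0]) f t.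
have IE (B C y : R) : 0 <= B -> B <= C -> - B <= y -> I B y = I C y.
  move=> B0 BC By; rewrite /I.
  rewrite (@Rintegral_chasles f (- C) (- B) y) ?lerN2//.
  by rewrite (@Rintegral_chasles f (- C) (- B) 0) ?lerN2 ?oppr_le0//; lra.
exists (fun y => I (`|y| + 1) y) => x.
(* The margin 2 ensures [|y| + 1 <= B] for every [y] within distance 1 of [x], where the moving base
   can then be replaced by the fixed one. *)
pose B := `|x| + 2.
have B0 : 0 < B by rewrite /B; have := normr_ge0 x; lra.
have xB : - B < x.
  by have := ler_norm (- x); rewrite normrN /B; lra.
have dI : is_derive x 1 (I B) (f x).
  have [||dx fx] := @continuous_FTC1_closed _ f (- B) x (x + 1) _ _ xB (cf x).
  - lra.
  - exact: continuous_integrable_itv.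
  have D1 : is_derive x 1 (fun y => \int[mu]_(t in `[- B, y]) f t) (f x).
    by split; [exact: dx|rewrite -derive1E; exact: fx].
  have := @is_deriveB _ _ _ _ _ _ _ _ _ D1
    (is_derive_cst (\int[mu]_(t in `[- B, 0]) f t) x 1).
  by rewrite subr0.
apply: near_eq_is_derive dI.
near=> y.
have yx : `|x - y| < 1.
  by near: y; apply: (@cvgr_dist_lt _ _ _ _ _ id x); [exact: cvg_id|].
rewrite -(IE (`|y| + 1) B).
- by [].
- by rewrite addr_ge0.
- rewrite /B; have := ler_distD x y 0.
  by rewrite !subr0 (distrC y x); lra.
- by have := ler_norm (- y); rewrite normrN; lra.
Unshelve. all: by end_near. Qed.

(** The derivative of [F (x + p) - F x] is [f (x + p) - f x = 0]. This moves the window of a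
    convolution integral back to [[-pi, pi]]. *)
Lemma periodic_increment F f (p : R) : periodic f p ->
  (forall x : R, is_derive x 1 F (f x)) ->
  forall x y, F (x + p) - F x = F (y + p) - F y.
Proof.
move=> fp dF x y.
apply: (@is_derive_0_is_cst _ (fun x => F (x + p) - F x)) => z.
have D1 : is_derive z 1 (F \o (fun u => u + p)) (f z).
  have := @is_derive1_comp _ F (id + cst p) z _ _ (dF (z + p))
    (is_deriveD (is_derive_id z 1) (is_derive_cst p z 1)).
  by rewrite fp addr0 mulr1.
by have := is_deriveB D1 (dF z); rewrite subrr.
Qed.

End antiderivative.

(** * Elementary bounds for the sine and the logarithm *)

Section half_sine.
Context {R : realType}.
Implicit Types x t : R.

Lemma sin_le_id x : 0 <= x -> sin x <= x.
Proof.
move=> x0; have := @le_increment _ sin id cos (cst 1) 0 x x0.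
rewrite sin0 !subr0; apply => y _; exact: cos_le1.
Qed.

Lemma cos_ge_taylor2 x : 0 <= x -> 1 - x ^+ 2 / 2 <= cos x.
Proof.
move=> x0.
have D (y : R) : is_derive y 1 (id ^+ 2 * cst 2^-1 : R -> R) y.
  by apply: is_derive_eq; rewrite /GRing.scale/=; lra.
have DN (y : R) : is_derive y 1 (- cos : R -> R) (sin y).
  by apply: is_derive_eq; rewrite opprK.
have := @le_increment _ _ _ _ _ 0 x x0 (fun y _ => DN y) (fun y _ => D y).
rewrite !fctE cos0 => /(_ _)/=H; suff : - cos x - - 1 <= x ^+ 2 / 2 - 0 ^+ 2 / 2 by lra.
apply: H => y; rewrite in_itv/= => /andP[y0 yx].
by apply: sin_le_id; exact: ltW.
Qed.

Lemma sin_ge_taylor3 x : 0 <= x -> x - x ^+ 3 / 6 <= sin x.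
Proof.
move=> x0.
have D (y : R) : is_derive y 1 (id - id ^+ 3 * cst 6^-1 : R -> R) (1 - y ^+ 2 / 2).
  by apply: is_derive_eq; rewrite /GRing.scale/=; lra.
have := @le_increment _ _ _ _ _ 0 x x0 (fun y _ => D y)
  (fun y _ => is_derive_sin y).
rewrite !fctE sin0 => H.
suff : x - x ^+ 3 / 6 - (0 - 0 ^+ 3 / 6) <= sin x - 0 by lra.
apply: H => y; rewrite in_itv/= => /andP[y0 yx].
by apply: cos_ge_taylor2; exact: ltW.
Qed.

Lemma sin_ge_third x : 0 <= x <= 2 -> x / 3 <= sin x.
Proof.
move=> /andP[x0 x2]; apply: le_trans (sin_ge_taylor3 _ x0).
have : x * x ^+ 2 <= x * 4 by rewrite ler_wpM2l//; nra.
have -> : x ^+ 3 = x * x ^+ 2 by ring.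
lra.
Qed.

Lemma pi_lt4 : pi < 4 :> R.
Proof. by have := @pihalf_lt2 R; lra. Qed.

(** The weight left by the first summation by parts. On ]0, pi] it exceeds [1 / t] by at most 1/2,
    which is what allows comparison with a logarithm. *)
Definition half_csc t := (2 * sin (t / 2))^-1.

Lemma half_sine_gt0 t : 0 < t <= pi -> 0 < 2 * sin (t / 2).
Proof.
move=> /andP[t0 tpi]; rewrite mulr_gt0// sin2_gt0//.
by have p4 := pi_lt4; apply/andP; split; lra.
Qed.

Lemma half_csc_ge t : 0 < t <= pi -> t^-1 <= half_csc t.
Proof.
move=> /andP[t0 tpi]; rewrite lef_pV2 ?posrE//; last exact/half_sine_gt0/andP.
have t20 : 0 <= t / 2 by lra.
by have := sin_le_id _ t20; lra.
Qed.

Lemma half_csc_le3 t : 0 < t <= pi -> half_csc t <= 3 / t.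
Proof.
move=> /andP[t0 tpi].
rewrite -invf_div lef_pV2 ?posrE ?divr_gt0//; last exact/half_sine_gt0/andP.
have H := sin_ge_third (t / 2); have p4 := pi_lt4.
by suff : t / 2 / 3 <= sin (t / 2); [lra|apply: H; apply/andP; split; lra].
Qed.

Lemma half_csc_le t : 0 < t <= pi -> half_csc t <= t^-1 + 2^-1.
Proof.
move=> /[dup] t0pi /andP[t0 tpi]; have p4 := pi_lt4.
have s0 := half_sine_gt0 _ t0pi.
have tN0 : t != 0 by rewrite gt_eqF.
rewrite /half_csc -div1r ler_pdivrMr//.
have H : t - t ^+ 3 / 24 <= 2 * sin (t / 2).
  have t20 : 0 <= t / 2 by lra.
  have := sin_ge_taylor3 _ t20.
  by rewrite expr_div_n; lra.
apply: le_trans (ler_wpM2l _ H); last by rewrite addr_ge0// invr_ge0 ltW.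
(* The last bracket decreases in [t] and vanishes exactly at [t = 4], beyond pi. *)
have -> : (t^-1 + 2^-1) * (t - t ^+ 3 / 24) = 1 + t / 2 * (1 - t / 12 - t ^+ 2 / 24).
  by field.
by rewrite lerDl mulr_ge0//; nra.
Qed.

Lemma half_csc_nincr s t : 0 < s -> s <= t -> t <= pi -> half_csc t <= half_csc s.
Proof.
move=> s0 st tpi; have p0 := pi_gt0 R.
rewrite lef_pV2 ?posrE ?half_sine_gt0//; [|apply/andP; split; lra..].
rewrite ler_pM2l//; move: st; rewrite le_eqVlt => /predU1P[->//|st].
by apply/ltW; rewrite ltr_sin// ?in_itv/=; [lra|apply/andP; split; lra..].
Qed.

Lemma ln_step_le (u v : R) : 0 < u -> 0 < v -> ln v - ln u <= (v - u) / u.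
Proof.
move=> u0 v0; rewrite -ln_div ?posrE//.
have -> : v / u = 1 + (v - u) / u by field; rewrite gt_eqF.
apply: le_ln1Dx.
have -> : (v - u) / u = v / u - 1 by field; rewrite gt_eqF.
by have : 0 < v / u; [rewrite divr_gt0|lra].
Qed.

Lemma ln_step_ge (u v : R) : 0 < u -> 0 < v -> (v - u) / v <= ln v - ln u.
Proof.
move=> u0 v0; have := ln_step_le v u v0 u0.
have -> : (u - v) / v = - ((v - u) / v) by ring.
lra.
Qed.

End half_sine.

(** * The coefficients *)

Lemma ler_powR_base {R : realType} (p x y : R) :
  0 < p -> 0 <= x -> x <= y -> x `^ p <= y `^ p.
Proof.
move=> p0 x0 xy; by apply: ge0_ler_powR; rewrite ?nnegrE; lra.
Qed.

Section coefficients.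
Context {R : realType} (alpha r : R).
Implicit Types x y : R.


Definition coef x := expR (- alpha * x `^ r).
Definition coef_slope x := alpha * r * x `^ (r - 1) * coef x.

Lemma coef_gt0 x : 0 < coef x.
Proof. exact: expR_gt0. Qed.

Lemma is_derive_coef x : 0 < x -> is_derive x 1 coef (- coef_slope x).
Proof.
move=> x0.
have D1 := is_derive1_powR r x0.
have D2 := is_deriveZ (- alpha) D1.
have := @is_derive1_comp _ expR _ x _ _ (is_derive_expR _) D2.
rewrite /comp /GRing.scale/=.
suff -> : expR (- alpha * x `^ r) * (- alpha * (r * x `^ (r - 1))) = - coef_slope x by [].
by rewrite /coef_slope /coef; ring.
Qed.

Lemma coef_slope_gt0 x (alpha0 : 0 < alpha) (r0 : 0 < r) (r1 : r < 1) : 0 < x -> 0 < coef_slope x.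
Proof. by move=> x0; rewrite !mulr_gt0 ?powR_gt0 ?coef_gt0. Qed.

Lemma coef_nincr x y (alpha0 : 0 < alpha) (r0 : 0 < r) (r1 : r < 1) : 0 <= x -> x <= y -> coef y <= coef x.
Proof.
move=> x0 xy; rewrite ler_expR !mulNr lerN2 ler_wpM2l ?(ltW alpha0)//.
by apply: ler_powR_base => //; lra.
Qed.

Lemma coef_slope_nincr x y (alpha0 : 0 < alpha) (r0 : 0 < r) (r1 : r < 1) : 0 < x -> x <= y -> coef_slope y <= coef_slope x.
Proof.
move=> x0 xy; have y0 : 0 < y by lra.
have a0 : 0 < alpha * r by rewrite mulr_gt0.
have q0 : 0 < 1 - r by lra.
have x0' := ltW x0.
apply: ler_pM.
- by rewrite ltW// mulr_gt0// powR_gt0.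
- exact/ltW/coef_gt0.
- rewrite ler_pM2l// -(opprB 1) !powRN lef_pV2 ?posrE ?powR_gt0//.
  exact: ler_powR_base.
- by apply: coef_nincr => //; lra.
Qed.

(** By the mean value theorem, with a monotone slope. Chained at k and k + 1 the two bounds give
    convexity of the coefficient sequence; the upper one at n produces the factor [d]. *)
Lemma coef_diff_bounds x (alpha0 : 0 < alpha) (r0 : 0 < r) (r1 : r < 1) : 0 < x ->
  coef_slope (x + 1) <= coef x - coef (x + 1) <= coef_slope x.
Proof.
move=> x0; have x1 : x < x + 1 by lra.
have pos y : y \in `]x, x + 1[ -> 0 < y by rewrite in_itv/= => /andP[? _]; lra.
have [|c] := MVT x1 (fun y yx => is_derive_coef y (pos y yx)).
  apply: derivable_within_continuous => y; rewrite in_itv/= => /andP[xy _].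
  have y0 : 0 < y by lra.
  by case: (is_derive_coef y y0).
rewrite in_itv/= => /andP[xc cx] E.
have -> : coef x - coef (x + 1) = coef_slope c.
  by rewrite -opprB E addrAC subrr add0r mulr1 opprK.
have c0 : 0 < c := lt_trans x0 xc.
by apply/andP; split; apply: coef_slope_nincr => //; exact: ltW.
Qed.

(* x^(1-r) psi(x) / (alpha r) is the leading term of the integral of psi over
   [x, +oo[; the factor 2 absorbs the correction. *)
Definition coef_primitive x := 2 / (alpha * r) * x `^ (1 - r) * coef x.

(** The derivative of [- coef_primitive] at y is psi(y) (2 - 2 (1 - r) / (alpha r y^r)), which is at
    least psi(y) once alpha r y^r >= 2. The right-hand side telescopes when summed. *)
Lemma coef_le_primitive_diff x (alpha0 : 0 < alpha) (r0 : 0 < r) (r1 : r < 1) : 0 < x -> 2 <= alpha * r * x `^ r ->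
  coef (x + 1) <= coef_primitive x - coef_primitive (x + 1).
Proof.
move=> x0 xr; pose a := alpha * r.
have a0 : 0 < a by rewrite mulr_gt0.
have D y : 0 < y -> is_derive y 1 (- coef_primitive)
    (- (2 / a * ((1 - r) * y `^ (- r) * coef y - y `^ (1 - r) * coef_slope y))).
  move=> y0.
  have D1 := is_deriveZ (2 / a) (is_deriveM (is_derive1_powR (1 - r) y0) (is_derive_coef _ y0)).
  have D2 := is_deriveN D1.
  have E : - ((2 / a) \*: ((@powR R)^~ (1 - r) * coef)) = - coef_primitive.
    by congr (- _); apply/funext => z; rewrite /coef_primitive -/a -mulrA.
  rewrite -E; apply: (is_derive_eq D2).
  by rewrite /GRing.scale/= (_ : 1 - r - 1 = - r); ring.
have pos y : y \in `[x, x + 1] -> 0 < y.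
  by rewrite in_itv/= => /andP[? _]; lra.
have DF (y : R) : is_derive y 1 (coef (x + 1) *: id : R -> R) (coef (x + 1)).
  by apply: is_derive_eq; rewrite /GRing.scale/= mulr1.
have := @le_increment _ _ _ _ _ x (x + 1) _
  (fun y _ => DF y) (fun y h => D y (pos y h)).
rewrite !fctE /GRing.scale/= => H.
suff : coef (x + 1) * (x + 1) - coef (x + 1) * x <=
  - coef_primitive (x + 1) - - coef_primitive x.
  by rewrite -mulrBr addrAC subrr add0r mulr1 opprK [leRHS]addrC.
apply: H => [|y]; first by lra.
rewrite in_itv/= => /andP[xy yx1]; have y0 : 0 < y by lra.
have cy : coef (x + 1) <= coef y by apply: coef_nincr => //; lra.
apply: (le_trans cy).
have yr : 2 <= a * y `^ r.
  apply: (le_trans xr); rewrite ler_wpM2l ?(ltW a0)//.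
  exact: ler_powR_base r0 (ltW x0) (ltW xy).
have yr0 : 0 < y `^ r by rewrite powR_gt0.
have -> : y `^ (1 - r) * coef_slope y = a * coef y.
  rewrite /coef_slope -/a.
  have -> : y `^ (1 - r) * (a * y `^ (r - 1) * coef y) =
    a * coef y * (y `^ (1 - r) * y `^ (r - 1)) by ring.
  rewrite -powRD; last by rewrite (gt_eqF y0) implybT.
  by rewrite (_ : 1 - r + (r - 1) = 0) ?powRr0 ?mulr1//; ring.
rewrite powRN.
have -> : - (2 / a * ((1 - r) * (y `^ r)^-1 * coef y - a * coef y)) =
    coef y * (2 - 2 * (1 - r) / (a * y `^ r)).
  by field; rewrite !gt_eqF.
rewrite ler_peMr ?(ltW (coef_gt0 _))//.
move: (a * y `^ r) yr => z z2.
suff : 2 * (1 - r) / z <= 1 by lra.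
by rewrite ler_pdivrMr//; lra.
Qed.

End coefficients.

(** In terms of y = n^(1-r) / (alpha r) the condition reads y/n (1 + ln (pi y)) + 1/y <= (3
    pi)^(-3), and y/n = 1 / (alpha r n^r). Once the logarithm is known to be nonnegative, y/n and
    1/y are each at most 6^(-3) = 1/216, since pi >= 2. *)
Lemma n1_cond_bounds {R : realType} (alpha r : R) (n : nat) :
  0 < alpha -> 0 < r -> r < 1 -> (0 < n)%N -> n1_cond alpha r n ->
  alpha * r / n%:R `^ (1 - r) <= 216^-1 /\ 216 <= alpha * r * n%:R `^ r.
Proof.
move=> alpha0 r0 r1 n0; rewrite /n1_cond.
set a := alpha * r; set y := n%:R `^ (1 - r) / a.
have a0 : 0 < a by rewrite mulr_gt0.
have nR : 1 <= n%:R :> R by rewrite ler1n.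
have n0R : 0 < n%:R :> R by rewrite ltr0n.
have u0 : 0 < n%:R `^ (1 - r) :> R by rewrite powR_gt0.
have v0 : 0 < n%:R `^ r :> R by rewrite powR_gt0.
have y0 : 0 < y by rewrite divr_gt0.
have p2 := pi_ge2 R.
have uv : n%:R `^ r * n%:R `^ (1 - r) = n%:R :> R.
  rewrite -powRD; last by rewrite (gt_eqF n0R) implybT.
  by rewrite addrC subrK powRr1// ltW.
rewrite (_ : pi * n%:R `^ (1 - r) / a = pi * y); last by rewrite /y mulrA.
rewrite (_ : a / n%:R `^ (1 - r) = y^-1); last by rewrite /y invf_div.
rewrite (_ : 1 / a * (1 / n%:R `^ r) = y / n%:R); last first.
  by rewrite -[in RHS]uv /y; field; rewrite !gt_eqF.
have c216 : 1 / (3 * pi) ^+ 3 <= 216^-1 :> R.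
  have p6 : 6 <= 3 * pi :> R by lra.
  rewrite div1r lef_pV2 ?posrE ?exprn_gt0//; last by lra.
  rewrite (_ : 216 = 6 ^+ 3); last by ring.
  by rewrite lerXn2r ?nnegrE//; lra.
have py0 : 0 < pi * y by rewrite mulr_gt0//; lra.
(* [ln x >= 1 - 1/x], which excludes that [ln] is very negative *)
have lnge : 1 - (pi * y)^-1 <= ln (pi * y).
  have := @le_ln1Dx R ((pi * y)^-1 - 1).
  rewrite (_ : 1 + ((pi * y)^-1 - 1) = (pi * y)^-1); last by lra.
  rewrite lnV ?posrE// => H.
  suff : - ln (pi * y) <= (pi * y)^-1 - 1 by lra.
  by apply: H; have : 0 < (pi * y)^-1; [rewrite invr_gt0|lra].
move=> C0.
have C : y / n%:R * (1 + ln (pi * y)) + y^-1 <= 216^-1 by exact: le_trans c216.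
have yn0 : 0 < y / n%:R by rewrite divr_gt0.
(* If y <= 1, the term 1/y is at least 1, and the other term, being at least -1/2, cannot bring the
   sum below 1/216. *)
have y1 : 1 < y.
  rewrite ltNge; apply/negP => yle1.
  have H1 : y / n%:R * (2 - (pi * y)^-1) <= y / n%:R * (1 + ln (pi * y)).
    by apply: ler_wpM2l; [exact: ltW|lra].
  have H2 : y / n%:R * (2 - (pi * y)^-1) = 2 * (y / n%:R) - (pi * n%:R)^-1.
    by field; rewrite !gt_eqF//; lra.
  have H3 : (pi * n%:R)^-1 <= 2^-1 :> R.
    by rewrite lef_pV2 ?posrE ?mulr_gt0//; nra.
  have H5 : 1 <= y^-1 by rewrite -invr1 lef_pV2 ?posrE.
  by lra.
have ln0 : 0 <= ln (pi * y) by apply: ln_ge0; nra.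
have yV0 : 0 < y^-1 by rewrite invr_gt0.
have H1 : y / n%:R <= y / n%:R * (1 + ln (pi * y)) by rewrite ler_peMr//; [exact: ltW|lra].
split; first by lra.
have : y / n%:R <= 216^-1 by lra.
have -> : y / n%:R = (a * n%:R `^ r)^-1.
  by rewrite -[in LHS]uv /y; field; rewrite !gt_eqF.
by rewrite lef_pV2 ?posrE ?mulr_gt0.
Qed.

(* [n1_cond] is not monotone in [n]: for small [r] it may fail beyond [n1].  The
   two bounds below, which follow from it at [n1], do propagate upwards. *)
Lemma n1_bounds {R : realType} (alpha r : R) (alpha_gt0 : 0 < alpha)
    (r01 : 0 < r < 1) (n : nat) : (n1 alpha_gt0 r01 <= n)%N ->
  [/\ (0 < n)%N, alpha * r / n%:R `^ (1 - r) <= 216^-1 &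
      216 <= alpha * r * n%:R `^ r].
Proof.
rewrite /n1; case: ex_minnP => m /andP[m0 mc] _ mn.
have /andP[r0 r1] := r01.
have n0 : (0 < n)%N by exact: leq_trans mn.
have mR : 0 < m%:R :> R by rewrite ltr0n.
have nR : 0 < n%:R :> R by rewrite ltr0n.
have a0 : 0 < alpha * r by rewrite mulr_gt0.
have mono p : 0 < p -> m%:R `^ p <= n%:R `^ p :> R.
  by move=> p0; apply: ge0_ler_powR; rewrite ?nnegrE ?ler_nat ?ltW.
have [H1 H2] := n1_cond_bounds _ _ _ alpha_gt0 r0 r1 m0 mc.
split => //.
- apply: le_trans H1; rewrite ler_pM2l// lef_pV2 ?posrE ?powR_gt0// mono//.
  by rewrite subr_gt0.
- by apply: (le_trans H2); rewrite ler_pM2l// mono.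
Qed.

(** * Cosine sums and series *)

Section uniform_limit.
Context {R : realType}.
Implicit Types (e : R^nat) (f : R -> R) (U : nat -> R -> R).

Lemma le_of_cvg0 (x a : R) e (m : nat) : e @ \oo --> 0 ->
  (forall n, (m <= n)%N -> x <= a + e n) -> x <= a.
Proof.
move=> e0 xa; apply/ler_addgt0Pr => eps eps0.
have /cvgr0Pnorm_lt/(_ _ eps0) : e @ \oo --> 0 by [].
move=> [N _ Ne]; have := xa (maxn m N) (leq_maxl _ _).
have := Ne (maxn m N) (leq_maxr _ _).
by move=> /=; have := ler_norm (e (maxn m N)); lra.
Qed.

Lemma uniform_limit_continuousR f U e :
  (forall n x, `|f x - U n x| <= e n) -> e @ \oo --> 0 ->
  (forall n, continuous (U n)) -> continuous f.
Proof.
move=> fU e0 cU x; apply/cvgrPdist_lt => eps eps0.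
have eps3 : 0 < eps / 3 by lra.
have /cvgr0Pnorm_lt/(_ _ eps3) [N _ Ne] : e @ \oo --> 0 by [].
have /= eN := Ne N (leqnn N).
have /cvgrPdist_lt/(_ _ eps3) := cU N x.
apply: filterS => y /= Uxy.
have e1 := fU N x; have e2 := fU N y; have e3 := ler_norm (e N).
have -> : f x - f y = (f x - U N x) + (U N x - U N y) - (f y - U N y) by ring.
have := ler_normB ((f x - U N x) + (U N x - U N y)) (f y - U N y).
have := ler_normD (f x - U N x) (U N x - U N y).
lra.
Qed.

(** Weierstrass' test with an explicit rate: the bound involves only [c], so it is uniform over
    every family dominated by [c]. *)
Lemma series_dominated_dist (a c : R^nat) : (forall j, `|a j| <= c j) ->
  cvgn (series c) ->
  forall M, `|limn (series a) - series a M| <= limn (series c) - series c M.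
Proof.
move=> ac cc M.
have c0 j : 0 <= c j by exact: le_trans (ac j).
have cn : cvgn [normed series a].
  by apply: series_le_cvg cc => // j; rewrite ?normr_ge0.
have ca := normed_cvg cn.
have ndc : {homo series c : n m / (n <= m)%N >-> n <= m}.
  by apply/nondecreasing_seqP => k; rewrite seriesEnat /= big_nat_recr//= lerDl.
have H N : (M <= N)%N -> `|series a N - series a M| <= limn (series c) - series c M.
  move=> MN; rewrite sub_series MN; apply: (le_trans (ler_norm_sum _ _ _)).
  apply: (@le_trans _ _ (series c N - series c M)).
    by rewrite sub_series MN; apply: ler_sum.
  by rewrite lerB// nondecreasing_cvgn_le.
have ea : (fun N => `|limn (series a) - series a N|) @ \oo --> 0.
  by apply/norm_cvg0P; rewrite -(subrr (limn (series a))); apply: cvgB => //; exact: cvg_cst.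
apply: (le_of_cvg0 _ _ _ M ea) => N MN.
have -> : limn (series a) - series a M =
  (limn (series a) - series a N) + (series a N - series a M) by ring.
by have := ler_normD (limn (series a) - series a N) (series a N - series a M);
  have := H N MN; lra.
Qed.

End uniform_limit.

(** * Summation by parts for cosine sums *)

Section cosine_sum.
Context {R : realType}.
Implicit Types (psi : R^nat) (b t : R).

Lemma sin_cos_step (A h : R) : 2 * sin h * cos A = sin (A + h) - sin (A - h).
Proof. by rewrite sinD sinB; ring. Qed.

Lemma sin_sin_step (A h : R) :
  2 * sin h * sin (A + h) = cos A - cos (A + h *+ 2).
Proof.
rewrite mulr2n addrA; set B := A + h.
by rewrite (_ : A = B - h) ?cosB ?cosD; [ring|rewrite /B; ring].
Qed.

Definition cos_sum psi b (n m : nat) t : R :=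
  \sum_(n <= k < m) psi k * cos (k%:R * t - b).

(* Two summations by parts, the second one on the sum of [D k * s k.+1]. *)
Lemma cos_sum_abel psi b n d t :
  let D k := psi k - psi k.+1 in
  let s k := sin ((k%:R - 2^-1) * t - b) in
  let c k := cos (k%:R * t - b) in
  let y := 2 * sin (t / 2) in
  y ^+ 2 * cos_sum psi b n (n + d) t =
  y * (psi (n + d)%N * s (n + d)%N - psi n * s n)
  + D n * c n - D (n + d)%N * c (n + d)%N
  - \sum_(n <= k < n + d) (D k - D k.+1) * c k.+1.
Proof.
move=> D s c y; rewrite /cos_sum.
have cs k : y * c k = s k.+1 - s k.
  rewrite /y /c /s sin_cos_step; congr (sin _ - sin _).
    by rewrite -[k.+1%:R]natr1; lra.
  by lra.
have sc k : y * s k.+1 = c k - c k.+1.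
  rewrite /y /c /s.
  have -> : (k.+1%:R - 2^-1) * t - b = k%:R * t - b + t / 2 by rewrite -[k.+1%:R]natr1; lra.
  rewrite sin_sin_step; congr (_ - cos _).
  by rewrite -[k.+1%:R]natr1 -mulr_natr; lra.
elim: d => [|d IH].
  by rewrite addn0 !big_geq//; ring.
rewrite addnS !big_nat_recr ?leq_addr//= mulrDr IH.
have E1 : y ^+ 2 * (psi (n + d)%N * c (n + d)%N) =
  y * psi (n + d)%N * (s (n + d).+1 - s (n + d)%N) by rewrite -cs; ring.
rewrite -/(c (n + d)%N) E1.
have E2 : D (n + d)%N * (c (n + d)%N - c (n + d).+1) =
  D (n + d)%N * y * s (n + d).+1 by rewrite -sc; ring.
have E3 : D (n + d)%N * y * s (n + d).+1 =
  y * (psi (n + d)%N * s (n + d).+1 - psi (n + d).+1 * s (n + d).+1).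
  by rewrite {1}/D; ring.
rewrite E3 in E2; lra.
Qed.

(** By convexity the second differences are nonnegative and their sum telescopes to D n - D m, with
    D k = psi k - psi k.+1. Together with the boundary terms D n and D m this makes 2 D n. The term
    [2 * psi m] vanishes in the limit. *)
Lemma cos_sum_abel_le psi b n m t : (n <= m)%N -> (forall k, 0 <= psi k) ->
  (forall k, (n <= k)%N -> 0 <= psi k - psi k.+1) ->
  (forall k, (n <= k)%N -> psi k.+1 - psi k.+2 <= psi k - psi k.+1) ->
  `|(2 * sin (t / 2)) ^+ 2 * cos_sum psi b n m t
    + psi n * (2 * sin (t / 2)) * sin ((n%:R - 2^-1) * t - b)|
  <= 2 * (psi n - psi n.+1) + 2 * psi m.
Proof.
move=> nm p0 D0 D1; set y := 2 * sin (t / 2).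
rewrite -(subnKC nm); move: (m - n)%N => d.
have := cos_sum_abel psi b n d t.
set s := fun k => sin ((k%:R - 2^-1) * t - b); set c := fun k => cos (k%:R * t - b).
set D := fun k => psi k - psi k.+1.
rewrite -/y => ->; rewrite -/(s n).
set Sg := \sum_(_ <= _ < _) _.
have S1 : `|Sg| <= D n - D (n + d)%N.
  have -> : D n - D (n + d)%N = \sum_(n <= k < n + d) (D k - D k.+1).
    rewrite -opprB -(telescope_sumr D (leq_addr d n)) -sumrN.
    by apply: eq_bigr => k _; rewrite opprB.
  apply: (le_trans (ler_norm_sum _ _ _)); rewrite big_nat [leRHS]big_nat.
  apply: ler_sum => k /andP[nk _]; rewrite normrM.
  have Dk : 0 <= D k - D k.+1 by rewrite subr_ge0; exact: D1.
  by rewrite ger0_norm// ler_piMr//; exact: cos_max.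
have y2 : `|y| <= 2 by rewrite normrM ger0_norm// ler_piMr// sin_max.
have H1 : `|y * (psi (n + d)%N * s (n + d)%N)| <= 2 * psi (n + d)%N.
  rewrite normrM; apply: ler_pM => //.
  by rewrite normrM ger0_norm// ler_piMr//; exact: sin_max.
have H2 : `|D n * c n| <= D n.
  by rewrite normrM ger0_norm ?D0// ler_piMr ?D0//; exact: cos_max.
have H3 : `|D (n + d)%N * c (n + d)%N| <= D (n + d)%N.
  by rewrite normrM ger0_norm ?D0 ?leq_addr// ler_piMr ?D0 ?leq_addr//; exact: cos_max.
set A := y * (psi (n + d)%N * s (n + d)%N) in H1.
set B := D n * c n in H2 *; set C := D (n + d)%N * c (n + d)%N in H3 *.
have -> : y * (psi (n + d)%N * s (n + d)%N - psi n * s n) + B - C - Sg +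
  psi n * y * s n = A + B - C - Sg by rewrite /A; ring.
have := ler_normB (A + B - C) Sg; have := ler_normB (A + B) C.
have := ler_normD A B; rewrite -/(D n); lra.
Qed.

Lemma cos_sum_norm_le psi b n m t : (forall k, 0 <= psi k) ->
  `|cos_sum psi b n m t| <= \sum_(n <= k < m) psi k.
Proof.
move=> p0; apply: (le_trans (ler_norm_sum _ _ _)); apply: ler_sum => k _.
by rewrite normrM ger0_norm// ler_piMr// cos_max.
Qed.

Lemma continuous_cos_affine (a c : R) : continuous (fun t : R => cos (a * t - c)).
Proof.
move=> t; apply: (@continuous_comp R R R (fun t : R => a * t - c) cos);
  last exact: continuous_cos.
by apply: cvgB; [apply: cvgM; [exact: cvg_cst|exact: cvg_id]|exact: cvg_cst].
Qed.

Lemma continuous_sumR (I : Type) (s : seq I) (F : I -> R -> R) :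
  (forall i, continuous (F i)) -> continuous (fun t => \sum_(i <- s) F i t).
Proof.
move=> cF; elim: s => [|i s IH] t.
  rewrite (_ : (fun t => _) = cst 0); first exact: cvg_cst.
  by apply/funext => u; rewrite big_nil.
rewrite (_ : (fun t => _) = F i \+ (fun t => \sum_(i <- s) F i t)).
  by apply: cvgD; [exact: cF|exact: IH].
by apply/funext => u; rewrite big_cons.
Qed.

Lemma continuous_cos_sum psi b n m : continuous (cos_sum psi b n m).
Proof.
apply: continuous_sumR => k t.
by apply: cvgM; [exact: cvg_cst|exact: continuous_cos_affine].
Qed.

End cosine_sum.

(** * Cosine series and their tails *)

Section cosine_series.
Context {R : realType}.
Implicit Types (psi : R^nat) (b t B : R).

(** For [psi k = coef alpha r k%:R] and [b = beta * pi / 2] this is convertible to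
    [poisson_kernel alpha r beta]. *)
Definition cos_series psi b t : R :=
  limn (series (fun j : nat => psi j.+1 * cos (j.+1%:R * t - b))).

Lemma sum_nat_le_split (c : R^nat) (n m : nat) : (forall k, 0 <= c k) ->
  \sum_(0 <= k < m) c k <= \sum_(0 <= k < n) c k + \sum_(n <= k < m) c k.
Proof.
move=> c0; have [nm|/ltnW mn] := leqP n m; first by rewrite -big_cat_nat.
rewrite [X in _ <= _ + X]big_geq// addr0 [leRHS](big_cat_nat (leq0n m) mn)//= lerDl.
by apply: sumr_ge0 => i _; exact: c0.
Qed.

Lemma is_cvg_series_tail_bounded psi n B : (forall k, 0 <= psi k) ->
  (forall m, \sum_(n <= k < m) psi k <= B) -> cvgn (series (fun j => psi j.+1)).
Proof.
move=> p0 pB; apply: nondecreasing_is_cvgn.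
  by apply/nondecreasing_seqP => k; rewrite seriesEnat /= big_nat_recr//= lerDl.
exists (\sum_(0 <= k < n) psi k + B) => _ [m _ <-].
rewrite seriesEnat /=.
apply: (@le_trans _ _ (\sum_(0 <= k < m.+1) psi k)).
  by rewrite big_nat_recl//= lerDr.
by apply: (le_trans (sum_nat_le_split _ n _ p0)); rewrite lerD2l.
Qed.

Lemma cos_series_dist psi b n B : (forall k, 0 <= psi k) ->
  (forall m, \sum_(n <= k < m) psi k <= B) ->
  exists2 e : R^nat, e @ \oo --> 0 &
    forall M t, `|cos_series psi b t - cos_sum psi b 1 M.+1 t| <= e M.
Proof.
move=> p0 pB; have cp := is_cvg_series_tail_bounded _ _ _ p0 pB.
set c := fun j => psi j.+1 in cp.
exists (fun M => limn (series c) - series c M).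
  by rewrite -(subrr (limn (series c))); apply: cvgB => //; exact: cvg_cst.
(* [series _ M] runs over [j < M], that is over the harmonics 1 to M, whence the bound [M.+1] in
   [cos_sum]. *)
move=> M t; rewrite /cos_sum big_add1/=.
have H j : `|psi j.+1 * cos (j.+1%:R * t - b)| <= c j.
  by rewrite normrM ger0_norm// ler_piMr// cos_max.
exact: (series_dominated_dist _ _ H cp M).
Qed.

Lemma continuous_cos_series psi b n B : (forall k, 0 <= psi k) ->
  (forall m, \sum_(n <= k < m) psi k <= B) -> continuous (cos_series psi b).
Proof.
move=> p0 pB; have [e e0 He] := cos_series_dist psi b n B p0 pB.
apply: (uniform_limit_continuousR _ (fun M => cos_sum psi b 1 M.+1) e) => //.
by move=> M; exact: continuous_cos_sum.
Qed.

(** The sum over k >= n, written as a difference so that it is at once the kernel of a function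
    minus its partial Fourier sum. *)
Definition cos_tail psi b n t := cos_series psi b t - cos_sum psi b 1 n t.

Lemma continuous_cos_tail psi b n B : (forall k, 0 <= psi k) ->
  (forall m, \sum_(n <= k < m) psi k <= B) -> continuous (cos_tail psi b n).
Proof.
move=> p0 pB t; apply: cvgB; first exact: (continuous_cos_series psi b n B p0 pB).
exact: continuous_cos_sum.
Qed.

Lemma cos_tail_periodic psi b n : periodic (cos_tail psi b n) (pi *+ 2).
Proof.
have cosk k (t : R) : cos (k%:R * (t + pi *+ 2) - b) = cos (k%:R * t - b).
  have -> : k%:R * (t + pi *+ 2) - b = k%:R * t - b + (pi *+ 2) *+ k.
    by rewrite -mulr_natl; ring.
  by rewrite (periodicn (@cosD2pi R)).
move=> t; rewrite /cos_tail /cos_series /cos_sum; congr (limn (series _) - _).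
  by apply/funext => j; rewrite cosk.
by apply: eq_bigr => k _; rewrite cosk.
Qed.

(** This lets the negative half-line be treated as the positive one with the opposite phase. *)
Lemma cos_tailN psi b n t : cos_tail psi b n (- t) = cos_tail psi (- b) n t.
Proof.
have cosk k : cos (k%:R * (- t) - b) = cos (k%:R * t - - b).
  by rewrite -cosN; congr cos; ring.
rewrite /cos_tail /cos_series /cos_sum; congr (limn (series _) - _).
  by apply/funext => j; rewrite cosk.
by apply: eq_bigr => k _; rewrite cosk.
Qed.

Lemma cos_tail_dist psi b n B : (0 < n)%N -> (forall k, 0 <= psi k) ->
  (forall m, \sum_(n <= k < m) psi k <= B) ->
  exists2 e : R^nat, e @ \oo --> 0 &
    forall M t, (n <= M.+1)%N -> `|cos_tail psi b n t - cos_sum psi b n M.+1 t| <= e M.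
Proof.
move=> n0 p0 pB; have [e e0 He] := cos_series_dist psi b n B p0 pB.
exists e => // M t nM; rewrite /cos_tail.
have := He M t.
by rewrite {1}/cos_sum (big_cat_nat n0 nM)/= -!/(cos_sum _ _ _ _ _) opprD addrA.
Qed.

Lemma cos_tail_norm_le psi b n B t : (0 < n)%N -> (forall k, 0 <= psi k) ->
  (forall m, \sum_(n <= k < m) psi k <= B) -> `|cos_tail psi b n t| <= B.
Proof.
move=> n0 p0 pB; have [e e0 He] := cos_tail_dist psi b n B n0 p0 pB.
apply: (le_of_cvg0 _ _ e n e0) => M nM.
have := He M t (leq_trans nM (leqnSn _)).
have := cos_sum_norm_le psi b n M.+1 t p0; have := pB M.+1.
have := ler_normD (cos_tail psi b n t - cos_sum psi b n M.+1 t) (cos_sum psi b n M.+1 t).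
rewrite subrK; lra.
Qed.

(** Limit of [cos_sum_abel_le]: psi tends to 0 because its series converges, and the truncation
    error is multiplied by (2 sin (t/2))^2 <= 4 only. *)
Lemma cos_tail_abel psi b n B t : (0 < n)%N -> (forall k, 0 <= psi k) ->
  (forall m, \sum_(n <= k < m) psi k <= B) ->
  (forall k, (n <= k)%N -> 0 <= psi k - psi k.+1) ->
  (forall k, (n <= k)%N -> psi k.+1 - psi k.+2 <= psi k - psi k.+1) ->
  `|(2 * sin (t / 2)) ^+ 2 * cos_tail psi b n t
    + psi n * (2 * sin (t / 2)) * sin ((n%:R - 2^-1) * t - b)|
  <= 2 * (psi n - psi n.+1).
Proof.
move=> n0 p0 pB D0 D1; have [e e0 He] := cos_tail_dist psi b n B n0 p0 pB.
have p00 := cvg_series_cvg_0 (is_cvg_series_tail_bounded _ _ _ p0 pB).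
have E0 : (fun M => 2 * psi M.+1 + 4 * e M) @ \oo --> 0.
  have -> : 0 = 2 * 0 + 4 * 0 :> R by ring.
  by apply: cvgD; apply: cvgM => //; exact: cvg_cst.
apply: (le_of_cvg0 _ _ _ n E0) => M nM.
have nM1 := leq_trans nM (leqnSn _).
have H1 := He M t nM1.
have H2 := cos_sum_abel_le psi b n M.+1 t nM1 p0 D0 D1.
set y := 2 * sin (t / 2) in H2 *; set q := cos_tail _ _ _ _ in H1 *.
set S := cos_sum _ _ _ _ _ in H1 H2.
set z := psi n * y * _ in H2 *.
have y2 : `|y| <= 2 by rewrite normrM ger0_norm// ler_piMr// sin_max.
have H3 : `|y ^+ 2 * (q - S)| <= 4 * e M.
  rewrite normrM normrX; apply: ler_pM => //.
  by have := normr_ge0 y; rewrite expr2; nra.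
have -> : y ^+ 2 * q + z = (y ^+ 2 * S + z) + y ^+ 2 * (q - S) by ring.
by have := ler_normD (y ^+ 2 * S + z) (y ^+ 2 * (q - S)); lra.
Qed.

(** [cos_tail_abel] divided by (2 sin (t/2))^2; with [half_csc_le3] the constant is 18 = 2 * 3^2. *)
Lemma cos_tail_main psi b n B t : (0 < n)%N -> (forall k, 0 <= psi k) ->
  (forall m, \sum_(n <= k < m) psi k <= B) ->
  (forall k, (n <= k)%N -> 0 <= psi k - psi k.+1) ->
  (forall k, (n <= k)%N -> psi k.+1 - psi k.+2 <= psi k - psi k.+1) ->
  0 < t <= pi ->
  `|cos_tail psi b n t + psi n * sin ((n%:R - 2^-1) * t - b) * half_csc t|
  <= 18 * (psi n - psi n.+1) / t ^+ 2.
Proof.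
move=> n0 p0 pB D0 D1 t0pi; have := cos_tail_abel psi b n B t n0 p0 pB D0 D1.
have h3 := half_csc_le3 _ t0pi; have y0 := half_sine_gt0 _ t0pi.
have /andP[t0 _] := t0pi.
rewrite /half_csc in h3 *; set y := 2 * sin (t / 2) in h3 y0 *.
have yV0 : 0 < y^-1 by rewrite invr_gt0.
set q := cos_tail _ _ _ _; set s := sin _ => H.
have -> : q + psi n * s * y^-1 = (y ^+ 2 * q + psi n * y * s) * y^-1 ^+ 2.
  by field; rewrite gt_eqF.
rewrite normrM [`|y^-1 ^+ 2|]ger0_norm ?exprn_ge0// ?(ltW yV0)//.
have -> : 18 * (psi n - psi n.+1) / t ^+ 2 = 2 * (psi n - psi n.+1) * (3 / t) ^+ 2.
  by field; rewrite gt_eqF.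
apply: ler_pM => //; first by rewrite exprn_ge0// ltW.
by rewrite lerXn2r ?nnegrE// ltW// divr_gt0.
Qed.

End cosine_series.

(** * The main term on a half-line *)

Section oscillating_kernel.
Context {R : realType}.
Implicit Types (q F G : R -> R) (A d N h b : R).

(* [A] is the leading coefficient psi(n), [d] the width of the core where only
   the trivial bound is available, and [h] half a period of the sine. *)
Record oscillating_kernel q A d N h b : Prop := {
  ok_A : 0 < A;
  ok_d : 0 < d;
  ok_d1 : d <= 216^-1;
  ok_h : 0 < h;
  ok_hd : 24 * h <= d;
  ok_N : N * h = pi;
  ok_near : forall t, `|q t| <= 3 * A / d;
  ok_far : forall t, 0 < t <= pi ->
    `|q t + A * sin (N * t - b) * half_csc t| <= 18 * (A * d) / t ^+ 2 }.

Lemma ok_N_gt0 q A d N h b : oscillating_kernel q A d N h b -> 0 < N.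
Proof.
case=> _ _ _ h0 _ Nh _ _; rewrite -(pmulr_lgt0 _ h0) Nh; exact: pi_gt0.
Qed.

(** On half a period the weight is frozen at a constant [K]; the comparison function, a sine plus
    the error [C / t ^+ 2], then has an elementary antiderivative. *)
Lemma is_derive_cell_majorant (K C N v t : R) : 0 < t -> 0 < N ->
  is_derive t 1 (fun x => - (K / N) * cos (N * (x - v)) - C * x^-1)
    (K * sin (N * (t - v)) + C / t ^+ 2).
Proof.
move=> t0 N0.
have D1 : is_derive t 1 ((N *: (id - cst v)) : R -> R) N.
  by apply: is_derive_eq; rewrite /GRing.scale/= subr0 mulr1.
have D2 := @is_derive1_comp _ cos (N *: (id - cst v)) t _ _
  (is_derive_cos (N * (t - v))) D1.
have D3 := is_deriveZ (- (K / N)) D2.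
have tN0 : (id : R -> R) t != 0 by rewrite gt_eqF.
have D4 := is_deriveV tN0 (is_derive_id t 1).
have D5 := is_deriveB D3 (is_deriveZ C D4).
apply: (is_derive_eq D5); rewrite /GRing.scale/=.
by field; rewrite !gt_eqF.
Qed.

Lemma sin_cell_ge0 N h v t : 0 < N -> N * h = pi -> v <= t -> t <= v + h ->
  0 <= sin (N * (t - v)).
Proof.
move=> N0 Nh vt tv; apply: sin_ge0_pi; apply/andP; split.
  by apply: mulr_ge0; [exact: ltW|lra].
by rewrite -Nh ler_pM2l//; lra.
Qed.

(** The mean 2 / pi of |sin| enters here: half a period contributes 2 K / N = (2 / pi) K h. *)
Lemma cos_cell_increment K C N h v : 0 < N -> 0 < h -> N * h = pi ->
  - (K / N) * cos (N * (v + h - v)) - C * (v + h)^-1 -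
  (- (K / N) * cos (N * (v - v)) - C * v^-1) =
  2 * K * h / pi + C * (v^-1 - (v + h)^-1).
Proof.
move=> N0 h0 Nh.
have -> : v + h - v = h by ring.
rewrite subrr mulr0 cos0 Nh cospi.
have -> : K / N = K * h / pi by rewrite -Nh; field; rewrite !gt_eqF.
by ring.
Qed.

(** Here [s] is the sign of the sine on the cell, and the decreasing weight is frozen at the left
    end, where it is largest. *)
Lemma half_cell_upper q A d N h b G (s v : R) : oscillating_kernel q A d N h b ->
  (forall x : R, is_derive x 1 G `|q x|) ->
  0 < v -> v + h <= pi -> `|s| = 1 ->
  (forall x, sin (N * (v + x) - b) = s * sin (N * x)) ->
  G (v + h) - G v <=
    A * (2 * half_csc v * h / pi + 18 * d * (v^-1 - (v + h)^-1)).
Proof.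
move=> ok dG v0 vpi s1 sv.
have N0 := ok_N_gt0 _ _ _ _ _ _ ok.
case: ok => A0 d0 _ h0 _ Nh _ far.
pose K := A * half_csc v; pose C := 18 * (A * d).
have -> : A * (2 * half_csc v * h / pi + 18 * d * (v^-1 - (v + h)^-1)) =
    2 * K * h / pi + C * (v^-1 - (v + h)^-1) by rewrite /K /C; ring.
rewrite -(cos_cell_increment K C N h v N0 h0 Nh).
have vh : v <= v + h by lra.
have pos t : t \in `[v, v + h] -> 0 < t.
  by rewrite in_itv/= => /andP[vt _]; exact: lt_le_trans vt.
apply: (le_increment _ _ _ _ v (v + h) vh (fun x _ => dG x)
  (fun x xI => is_derive_cell_majorant K C N v x (pos x xI) N0)) => t.
rewrite in_itv/= => /andP[vt tv].
have t0pi : 0 < t <= pi by apply/andP; split; lra.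
have sg := sin_cell_ge0 N h v t N0 Nh (ltW vt) (ltW tv).
have w0 : 0 < half_csc t by rewrite invr_gt0 half_sine_gt0.
have := far t t0pi; rewrite -/C.
have -> : sin (N * t - b) = s * sin (N * (t - v)).
  by rewrite -sv; congr (sin (N * _ - _)); ring.
set S := sin _ in sg *; move=> H.
have wle : half_csc t <= half_csc v by apply: half_csc_nincr; lra.
have E : `|A * (s * S) * half_csc t| = A * half_csc t * S.
  by rewrite !normrM s1 mul1r !ger0_norm ?(ltW w0) ?(ltW A0)//; ring.
have H2 : A * half_csc t * S <= K * S.
  by rewrite ler_wpM2r// ler_pM2l.
have := ler_normB (q t + A * (s * S) * half_csc t) (A * (s * S) * half_csc t).
by rewrite addrK E; lra.
Qed.

(** The main term of [q] carries a minus sign, so where the sine has sign [s] it is [- s * q] that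
    is nearly A |sin| times the weight. The weight is now frozen at the right end, where it is
    smallest, and the error enters with negative [C]. *)
Lemma half_cell_lower q A d N h b F (s v : R) : oscillating_kernel q A d N h b ->
  (forall x : R, is_derive x 1 F (q x)) ->
  0 < v -> v + h <= pi -> `|s| = 1 ->
  (forall x, sin (N * (v + x) - b) = s * sin (N * x)) ->
  A * (2 * half_csc (v + h) * h / pi - 18 * d * (v^-1 - (v + h)^-1)) <=
  - s * (F (v + h) - F v).
Proof.
move=> ok dF v0 vpi s1 sv.
have N0 := ok_N_gt0 _ _ _ _ _ _ ok.
case: ok => A0 d0 _ h0 _ Nh _ far.
pose K := A * half_csc (v + h); pose C := - (18 * (A * d)).
have -> : A * (2 * half_csc (v + h) * h / pi - 18 * d * (v^-1 - (v + h)^-1)) =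
    2 * K * h / pi + C * (v^-1 - (v + h)^-1) by rewrite /K /C; ring.
rewrite -(cos_cell_increment K C N h v N0 h0 Nh).
have vh : v <= v + h by lra.
have pos t : t \in `[v, v + h] -> 0 < t.
  by rewrite in_itv/= => /andP[vt _]; exact: lt_le_trans vt.
have dsF (x : R) : is_derive x 1 (fun x => - s * F x) (- s * q x) by exact: is_deriveZ.
rewrite [leRHS]mulrBr.
apply: (le_increment _ _ _ _ v (v + h) vh
  (fun x xI => is_derive_cell_majorant K C N v x (pos x xI) N0)
  (fun x _ => dsF x)) => t.
rewrite in_itv/= => /andP[vt tv].
have t0pi : 0 < t <= pi by apply/andP; split; lra.
have sg := sin_cell_ge0 N h v t N0 Nh (ltW vt) (ltW tv).
have := far t t0pi.
have -> : sin (N * t - b) = s * sin (N * (t - v)).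
  by rewrite -sv; congr (sin (N * _ - _)); ring.
set S := sin _ in sg *; move=> H.
have wle : half_csc (v + h) <= half_csc t by apply: half_csc_nincr; lra.
have H2 : K * S <= A * half_csc t * S.
  by rewrite ler_wpM2r// ler_pM2l.
have ss : s * s = 1 by rewrite -expr2 -(real_normK (num_real s)) s1 expr1n.
have E : - s * q t = A * half_csc t * S - s * (q t + A * (s * S) * half_csc t).
  rewrite mulrDr.
  have -> : s * (A * (s * S) * half_csc t) = s * s * (A * half_csc t * S) by ring.
  by rewrite ss mul1r; ring.
rewrite E.
have := ler_norm (s * (q t + A * (s * S) * half_csc t)).
by rewrite normrM s1 mul1r /C mulNr; lra.
Qed.

End oscillating_kernel.

(** * Summation over whole periods *)

Section cells.
Context {R : realType}.
Implicit Types (q F G : R -> R) (A d N h b : R).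

(** Says that [u] is an upward zero of sin (N t - b), in the form of an identity usable on a whole
    period. *)
Definition phase_aligned N b u := forall x, sin (N * (u + x) - b) = sin (N * x).

Lemma phase_aligned_half N h b u : N * h = pi -> phase_aligned N b u ->
  forall x, sin (N * (u + h + x) - b) = - 1 * sin (N * x).
Proof.
move=> Nh au x; rewrite -addrA au mulrDr Nh addrC sinDpi; ring.
Qed.

Lemma phase_aligned_shift N h b u i : N * h = pi -> phase_aligned N b u ->
  phase_aligned N b (u + h *+ 2 *+ i).
Proof.
move=> Nh au x; rewrite -addrA au.
have -> : N * (h *+ 2 *+ i + x) = N * x + (pi *+ 2) *+ i.
  by rewrite mulrDr addrC !mulrnAr Nh.
by rewrite (periodicn (@sinD2pi R)).
Qed.

Lemma periodic_int (f : R -> R) (p : R) : periodic f p ->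
  forall (z : int) x, f (x + p *~ z) = f x.
Proof.
move=> fp [k|k] x; first exact: periodicn.
rewrite NegzE mulrNz -pmulrn.
by rewrite -(periodicn fp k.+1 (x - p *+ k.+1)) subrK.
Qed.

Lemma exists_phase_aligned N h b (c : R) : 0 < h -> N * h = pi ->
  exists u, [/\ c <= u, u <= c + h *+ 2 & phase_aligned N b u].
Proof.
move=> h0 Nh.
have N0 : 0 < N by rewrite -(pmulr_lgt0 _ h0) Nh pi_gt0.
(* The phase at [c] counted in full turns; its ceiling marks the next upward zero. *)
pose w := (N * c - b) / (pi *+ 2).
have pp : 0 < pi *+ 2 :> R by rewrite pmulrn_lgt0// pi_gt0.
have wE : N * c - b = w * (pi *+ 2) by rewrite /w divfK// gt_eqF.
have /andP[] := ceil_itv w; move: (Num.ceil w) => z.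
rewrite intrD => zl zr.
exists ((z%:~R * (pi *+ 2) + b) / N).
have E : pi *+ 2 = N * (h *+ 2) by rewrite mulrnAr Nh.
split.
- rewrite ler_pdivlMr// mulrC -lerBlDr wE.
  by rewrite ler_pM2r.
- rewrite ler_pdivrMr//.
  have H : z%:~R * (pi *+ 2) <= (w + 1) * (pi *+ 2) by rewrite ler_pM2r//; lra.
  by move: H; rewrite mulrDl mul1r -wE E; lra.
- move=> x.
  rewrite -[RHS](periodic_int _ _ (@sinD2pi R) z) -mulrzl; congr sin.
  by field; rewrite gt_eqF.
Qed.

(* The weight on a period is at most its value at the left end [v], and [1 / v]
   times the period is at most the increment of [ln] over the preceding period,
   whence the telescoping sum. *)
Lemma cells_upper q A d N h b G u (m : nat) : oscillating_kernel q A d N h b ->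
  (forall x : R, is_derive x 1 G `|q x|) -> phase_aligned N b u ->
  h *+ 2 < u -> u + h *+ 2 *+ m <= pi ->
  G (u + h *+ 2 *+ m) - G u <=
    A * (2 / pi * (ln (u + h *+ 2 *+ m - h *+ 2) - ln (u - h *+ 2)) +
         (h *+ 2 *+ m) / pi + 18 * d * (u^-1 - (u + h *+ 2 *+ m)^-1)).
Proof.
move=> ok dG au hu.
have [A0 d0 _ h0 _ Nh _ _] := ok.
have p0 := pi_gt0 R.
elim: m => [|m IH].
  by rewrite !mulr0n !addr0 !subrr mul0r !mulr0 !addr0 mulr0.
rewrite mulrSr addrA => um.
set v := u + h *+ 2 *+ m in IH um *.
have h20 : 0 < h *+ 2 by rewrite pmulrn_lgt0.
have hv : h *+ 2 < v.
  by rewrite /v (lt_le_trans hu)// lerDl mulrn_wge0// ltW.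
have v0 : 0 < v by lra.
have av := phase_aligned_shift _ _ _ _ m Nh au; rewrite -/v in av.
have vpi : v <= pi by lra.
have {}IH := IH vpi.
have E2 : v + h *+ 2 = v + h + h by rewrite mulr2n addrA.
have vh0 : 0 < v + h by lra.
have vhpi : v + h <= pi by lra.
have vhhpi : v + h + h <= pi by lra.
have v0pi : 0 < v <= pi by rewrite v0.
have C1 := half_cell_upper q A d N h b G 1 v ok dG v0 vhpi (normr1 _)
  (fun x => etrans (av x) (esym (mul1r _))).
have C2 := half_cell_upper q A d N h b G (- 1) (v + h) ok dG vh0 vhhpi
  (normrN1 _) (phase_aligned_half _ _ _ _ Nh av).
have w1 := half_csc_le _ v0pi.
have w2 : half_csc (v + h) <= half_csc v by apply: half_csc_nincr; lra.
have L := ln_step_ge (v - h *+ 2) v ltac:(lra) v0.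
set (p := @pi R) in *; clearbody p.
have hp0 : 0 < 2 * h / p by rewrite divr_gt0// mulr_gt0.
have L2 : 4 * h / p * v^-1 <= 2 / p * (ln v - ln (v - h *+ 2)).
  have -> : 4 * h / p * v^-1 = 2 / p * ((v - (v - h *+ 2)) / v).
    by field; rewrite !gt_eqF.
  by apply: ler_wpM2l => //; rewrite divr_ge0// ltW.
(* The excess 1/2 of the weight over [1 / v] costs 2 h / pi per period, which adds up to the term
   [(h *+ 2 *+ m) / pi]. *)
have W1 : 2 * half_csc v * h / p <= 2 * h / p * (v^-1 + 2^-1).
  have -> : 2 * half_csc v * h / p = 2 * h / p * half_csc v by ring.
  by rewrite ler_pM2l.
have W2 : 2 * half_csc (v + h) * h / p <= 2 * h / p * (v^-1 + 2^-1).
  have -> : 2 * half_csc (v + h) * h / p = 2 * h / p * half_csc (v + h) by ring.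
  by rewrite ler_pM2l//; lra.
rewrite E2 (_ : v + h + h - h *+ 2 = v); last by rewrite mulr2n; ring.
set X1 := (X in _ <= A * X) in C1; set X2 := (X in _ <= A * X) in C2.
set Y := (X in _ <= A * X) in IH.
set Z := (X in _ <= A * X).
have key : Y + (X1 + X2) <= Z.
  rewrite /Y /X1 /X2 /Z; clear -L2 W1 W2; lra.
have := ler_wpM2l (ltW A0) key.
rewrite [A * (Y + _)]mulrDr [A * (X1 + _)]mulrDr; clear -C1 C2 IH; lra.
Qed.

(** Mirror image of [cells_upper]: on a period the weight is at least [1 / w], with [w] the right
    end, and the period times [1 / w] dominates the increment of [ln] over the following period.
    Each summand is the integral of [q] over the second half of a period minus that over the first,
    that is, against the negated sign of the sine. *)
Lemma cells_lower q A d N h b F u (m : nat) : oscillating_kernel q A d N h b ->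
  (forall x : R, is_derive x 1 F (q x)) -> phase_aligned N b u ->
  0 < u -> u + h *+ 2 *+ m <= pi ->
  A * (2 / pi * (ln (u + h *+ 2 *+ m + h *+ 2) - ln (u + h *+ 2))
       - 18 * d * (u^-1 - (u + h *+ 2 *+ m)^-1)) <=
  \sum_(0 <= i < m)
    let v := u + h *+ 2 *+ i in F (v + h + h) - F (v + h) - (F (v + h) - F v).
Proof.
move=> ok dF au u0.
have [A0 d0 _ h0 _ Nh _ _] := ok.
have p0 := pi_gt0 R.
elim: m => [|m IH].
  by rewrite big_geq// !mulr0n !addr0 !subrr !mulr0 subrr mulr0.
rewrite big_nat_recr//= mulrSr addrA => um.
set v := u + h *+ 2 *+ m in IH um *.
have h20 : 0 < h *+ 2 by rewrite pmulrn_lgt0.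
have v0 : 0 < v.
  by rewrite /v (lt_le_trans u0)// lerDl mulrn_wge0// ltW.
have av := phase_aligned_shift _ _ _ _ m Nh au; rewrite -/v in av.
have vpi : v <= pi by lra.
have {}IH := IH vpi.
have E2 : v + h *+ 2 = v + h + h by rewrite mulr2n addrA.
have vh0 : 0 < v + h by lra.
have vhpi : v + h <= pi by lra.
have vhhpi : v + h + h <= pi by lra.
have vhhpi2 : 0 < v + h + h <= pi by apply/andP; split; lra.
have C1 := half_cell_lower q A d N h b F 1 v ok dF v0 vhpi (normr1 _)
  (fun x => etrans (av x) (esym (mul1r _))).
have C2 := half_cell_lower q A d N h b F (- 1) (v + h) ok dF vh0 vhhpi
  (normrN1 _) (phase_aligned_half _ _ _ _ Nh av).
have w1 := half_csc_ge _ vhhpi2.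
have w2 : half_csc (v + h + h) <= half_csc (v + h) by apply: half_csc_nincr; lra.
have L := ln_step_le (v + h + h) (v + h + h + h *+ 2) ltac:(lra) ltac:(lra).
set (p := @pi R) in *; clearbody p.
have hp0 : 0 < 2 * h / p by rewrite divr_gt0// mulr_gt0.
have L2 : 2 / p * (ln (v + h + h + h *+ 2) - ln (v + h + h)) <=
    4 * h / p * (v + h + h)^-1.
  have -> : 4 * h / p * (v + h + h)^-1 =
      2 / p * ((v + h + h + h *+ 2 - (v + h + h)) / (v + h + h)).
    by field; rewrite !gt_eqF//; lra.
  by apply: ler_wpM2l => //; rewrite divr_ge0// ltW.
have W1 : 2 * h / p * (v + h + h)^-1 <= 2 * half_csc (v + h) * h / p.
  have -> : 2 * half_csc (v + h) * h / p = 2 * h / p * half_csc (v + h) by ring.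
  by rewrite ler_pM2l//; lra.
have W2 : 2 * h / p * (v + h + h)^-1 <= 2 * half_csc (v + h + h) * h / p.
  have -> : 2 * half_csc (v + h + h) * h / p = 2 * h / p * half_csc (v + h + h) by ring.
  by rewrite ler_pM2l.
rewrite E2.
set X1 := (X in A * X <= _) in C1; set X2 := (X in A * X <= _) in C2.
set Y := (X in A * X <= _) in IH.
set Z := (X in A * X <= _).
have key : Z <= Y + (X1 + X2).
  rewrite /Y /X1 /X2 /Z E2; clear -L2 W1 W2; lra.
have := ler_wpM2l (ltW A0) key.
rewrite [A * (Y + _)]mulrDr [A * (X1 + _)]mulrDr; clear -C1 C2 IH; lra.
Qed.

End cells.

(** * Assembling the half-line estimates *)

Section half_line.
Context {R : realType}.
Implicit Types (q F G : R -> R) (A d N h b : R).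

Lemma ln2_le1 : ln 2 <= 1 :> R.
Proof. by have := @le_ln1Dx R 1; rewrite (_ : 1 + 1 = 2)//; apply; lra. Qed.

Lemma exists_grid_end (h u p : R) : 0 < h -> u <= p ->
  exists m, u + h *+ m <= p < u + h *+ m + h.
Proof.
move=> h0 up; have x0 : 0 <= (p - u) / h by rewrite divr_ge0 ?subr_ge0// ltW.
have /andP[ml mr] := truncn_itv x0.
exists (Num.truncn ((p - u) / h)); move: (Num.truncn _) ml mr => m ml mr.
rewrite -addrA -mulrSr -lerBrDl -ltrBlDl.
rewrite -[h *+ m]mulr_natl -[h *+ m.+1]mulr_natl.
by rewrite -ler_pdivlMr// ml -ltr_pdivrMr.
Qed.

(** Crude bound for the pieces outside the whole periods: |sin| <= 1 and the weight is at most
    [3 / u]. It is affordable because such pieces are short. *)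
Lemma far_increment q A d N h b G (u v : R) : oscillating_kernel q A d N h b ->
  (forall x : R, is_derive x 1 G `|q x|) -> 0 < u -> u <= v -> v <= pi ->
  G v - G u <= A * (3 * (v - u) / u + 18 * d / u).
Proof.
move=> ok dG u0 uv vpi.
have N0 := ok_N_gt0 _ _ _ _ _ _ ok.
have [A0 d0 _ _ _ _ _ far] := ok.
pose C := 18 * (A * d).
have pos t : t \in `[u, v] -> 0 < t.
  by rewrite in_itv/= => /andP[ut _]; exact: lt_le_trans ut.
(* The cell majorant with [K = 0] supplies the antiderivative of [C / x ^+ 2]. *)
have D (x : R) : x \in `[u, v] -> is_derive x 1
   (fun x => 3 * A / u * x + (- (0 / N) * cos (N * (x - 0)) - C * x^-1))
   (3 * A / u + (0 * sin (N * (x - 0)) + C / x ^+ 2)).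
  move=> /pos x0.
  have D1 := is_deriveZ (3 * A / u) (is_derive_id x (1 : R)).
  have := is_deriveD D1 (is_derive_cell_majorant 0 C N 0 x x0 N0).
  by rewrite /GRing.scale/= mulr1.
have H := le_increment _ _ _ _ u v uv (fun x _ => dG x) D.
have {}H : G v - G u <= 3 * A / u * (v - u) + (C * u^-1 - C * v^-1).
  apply: (le_trans (H _)); last by rewrite mul0r; lra.
  move=> t; rewrite in_itv/= => /andP[ut tv].
  have t0 : 0 < t by exact: lt_trans ut.
  have t0pi : 0 < t <= pi by apply/andP; split; lra.
  have w3 := half_csc_le3 _ t0pi.
  have w0 : 0 < half_csc t by rewrite invr_gt0 half_sine_gt0.
  have tu : t^-1 <= u^-1 by rewrite lef_pV2 ?posrE// ltW.
  have := far t t0pi; rewrite -/C.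
  set S := sin _; move=> Hf.
  have E : `|A * S * half_csc t| <= A * half_csc t.
    rewrite !normrM (gtr0_norm A0) (gtr0_norm w0).
    by rewrite ler_pM2r// ler_piMr ?sin_max// ltW.
  have E2 : A * half_csc t <= 3 * A / u.
    have -> : 3 * A / u = A * (3 * u^-1) by ring.
    by rewrite ler_pM2l//; apply: (le_trans w3); rewrite ler_pM2l.
  have := ler_normB (q t + A * S * half_csc t) (A * S * half_csc t).
  by rewrite addrK mul0r add0r; clear -Hf E E2; lra.
apply: (le_trans H).
have v0 : 0 < v by exact: lt_le_trans uv.
have vV : 0 < C * v^-1 by rewrite mulr_gt0 ?invr_gt0// /C !mulr_gt0.
have -> : A * (3 * (v - u) / u + 18 * d / u) = 3 * A / u * (v - u) + C * u^-1.
  by rewrite /C; ring.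
by clear -vV; lra.
Qed.

Lemma near_increment q A d N h b G : oscillating_kernel q A d N h b ->
  (forall x : R, is_derive x 1 G `|q x|) -> G d - G 0 <= 3 * A.
Proof.
move=> [A0 d0 _ _ _ _ near _] dG.
have D (x : R) : is_derive x 1 (fun x => 3 * A / d * x) (3 * A / d).
  have := is_deriveZ (3 * A / d) (is_derive_id x (1 : R)).
  by rewrite /GRing.scale/= mulr1.
have := le_increment _ _ _ _ 0 d (ltW d0) (fun x _ => dG x) (fun x _ => D x)
  (fun x _ => near x).
by rewrite mulr0 subr0 divfK ?gt_eqF.
Qed.

(** The segment is cut at [d], at the aligned point [u] and at the last grid point [v]; the four
    pieces cost 3 + 19 + 20 + 19 = 61. In the third, 20 is 1 for the shift of the logarithm, 1 for
    the excess of the weight over [1 / t] and 18 for the error of order [1 / t ^+ 2]. *)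
Lemma half_line_upper q A d N h b G : oscillating_kernel q A d N h b ->
  (forall x : R, is_derive x 1 G `|q x|) ->
  G pi - G 0 <= A * (2 / pi * ln (pi / d) + 61).
Proof.
move=> ok dG; have [A0 d0 d1 h0 hd Nh _ _] := ok.
have p2 := pi_ge2 R.
have [u [du ud au]] := exists_phase_aligned N h b d h0 Nh.
have h20 : 0 < h *+ 2 by rewrite pmulrn_lgt0.
have u0 : 0 < u by lra.
have up : u <= pi - h *+ 2 by lra.
have [m /andP[ml mr]] := exists_grid_end (h *+ 2) u _ h20 up.
have C1 := near_increment _ _ _ _ _ _ _ ok dG.
have C2 := far_increment _ _ _ _ _ _ _ d u ok dG d0 du ltac:(lra).
have hu : h *+ 2 < u by lra.
have mpi : u + h *+ 2 *+ m <= pi by lra.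
have C3 := cells_upper _ _ _ _ _ _ _ u m ok dG au hu mpi.
have um : u <= u + h *+ 2 *+ m by rewrite lerDl mulrn_wge0// ltW.
have v0 : 0 < u + h *+ 2 *+ m by lra.
have C4 := far_increment _ _ _ _ _ _ _ _ pi ok dG v0 mpi (lexx _).
set v := u + h *+ 2 *+ m in C3 C4 um mpi ml mr v0.
have mE : h *+ 2 *+ m = v - u by rewrite /v addrC addKr.
rewrite mE in C3.
clearbody v.
set (p := @pi R) in *; clearbody p.
have p0 : 0 < p by lra.
have E2 : 3 * (u - d) / d + 18 * d / d <= 19.
  have -> : 3 * (u - d) / d + 18 * d / d = 3 * (u - d) / d + 18.
    by field; rewrite gt_eqF.
  suff : 3 * (u - d) / d <= 1 by lra.
  by rewrite ler_pdivrMr//; lra.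
have E4 : 3 * (p - v) / v + 18 * d / v <= 19.
  have -> : 3 * (p - v) / v + 18 * d / v = (3 * (p - v) + 18 * d) / v by ring.
  by rewrite ler_pdivrMr//; lra.
have E3 : 2 / p * (ln (v - h *+ 2) - ln (u - h *+ 2)) + (v - u) / p +
    18 * d * (u^-1 - v^-1) <= 2 / p * ln (p / d) + 19 + 1.
  have L1 : ln (v - h *+ 2) <= ln p by rewrite ler_ln ?posrE//; lra.
  have L2 : ln (d / 2) <= ln (u - h *+ 2) by rewrite ler_ln ?posrE//; lra.
  rewrite ln_div ?posrE// in L2; rewrite ln_div ?posrE//.
  have L3 : (v - u) / p <= 1 by rewrite ler_pdivrMr//; lra.
  have L4 : 18 * d * (u^-1 - v^-1) <= 18.
    have dv : 0 < d * v^-1 by rewrite mulr_gt0// invr_gt0.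
    have : d / u <= 1 by rewrite ler_pdivrMr//; lra.
    by clear -dv; lra.
  have p1 : 2 / p <= 1 by rewrite ler_pdivrMr//; lra.
  have pp : 0 <= 2 / p by rewrite divr_ge0// ltW.
  have L5 : 2 / p * (ln (v - h *+ 2) - ln (u - h *+ 2)) <= 2 / p * (ln p - ln d + 1).
    by apply: ler_wpM2l => //; have := ln2_le1; clear -L1 L2; lra.
  by clear -L3 L4 L5 p1; lra.
have {}C2 := le_trans C2 (ler_wpM2l (ltW A0) E2).
have {}C3 := le_trans C3 (ler_wpM2l (ltW A0) E3).
have {}C4 := le_trans C4 (ler_wpM2l (ltW A0) E4).
by clear -C1 C2 C3 C4 A0; lra.
Qed.

(** Only whole periods are kept, since the extremal function may vanish elsewhere. The loss 20 is 18
    for the error of order [1 / t ^+ 2] and 2 for the factors 2 lost inside the two logarithms. *)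
Lemma half_line_lower q A d N h b F : oscillating_kernel q A d N h b ->
  (forall x : R, is_derive x 1 F (q x)) ->
  exists u m, [/\ 0 < u, u + h *+ 2 *+ m < pi &
    A * (2 / pi * ln (pi / d) - 20) <= \sum_(0 <= i < m)
      let v := u + h *+ 2 *+ i in F (v + h + h) - F (v + h) - (F (v + h) - F v)].
Proof.
move=> ok dF; have [A0 d0 d1 h0 hd Nh _ _] := ok.
have p2 := pi_ge2 R.
have [u [du ud au]] := exists_phase_aligned N h b d h0 Nh.
have h20 : 0 < h *+ 2 by rewrite pmulrn_lgt0.
have u0 : 0 < u by lra.
(* The grid is stopped at [pi - h *+ 2], so that the last period ends strictly before pi. *)
have up : u <= pi - h *+ 2 by lra.
have [m /andP[ml mr]] := exists_grid_end (h *+ 2) u _ h20 up.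
exists u, m; split => //; first by lra.
have mpi : u + h *+ 2 *+ m <= pi by lra.
apply: le_trans (cells_lower _ _ _ _ _ _ _ u m ok dF au u0 mpi).
have um : u <= u + h *+ 2 *+ m by rewrite lerDl mulrn_wge0// ltW.
have v0 : 0 < u + h *+ 2 *+ m by lra.
set v := u + h *+ 2 *+ m in um mpi ml mr v0 *.
clearbody v.
set (p := @pi R) in *; clearbody p.
have p0 : 0 < p by lra.
rewrite ler_pM2l//.
have L1 : ln (p / 2) <= ln (v + h *+ 2) by rewrite ler_ln ?posrE//; lra.
have L2 : ln (u + h *+ 2) <= ln (d * 2) by rewrite ler_ln ?posrE//; lra.
rewrite ln_div ?posrE// in L1; rewrite lnM ?posrE// in L2; rewrite ln_div ?posrE//.
have L4 : 18 * d * (u^-1 - v^-1) <= 18.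
  have dv : 0 < d * v^-1 by rewrite mulr_gt0// invr_gt0.
  have : d / u <= 1 by rewrite ler_pdivrMr//; lra.
  by clear -dv; lra.
have p1 : 2 / p <= 1 by rewrite ler_pdivrMr//; lra.
have pp : 0 <= 2 / p by rewrite divr_ge0// ltW.
have L5 : 2 / p * (ln p - ln d - 2) <= 2 / p * (ln (v + h *+ 2) - ln (u + h *+ 2)).
  by apply: ler_wpM2l => //; have := ln2_le1; clear -L1 L2; lra.
by clear -L4 L5 p1; lra.
Qed.

End half_line.

(** * The tail of the Poisson kernel as an oscillating kernel *)

Section exponential_tail.
Context {R : realType}.
Variables (alpha r : R) (n : nat).
Notation psi := (fun k : nat => coef alpha r k%:R).
Notation d := (alpha * r / n%:R `^ (1 - r)).

(** The first term is at most psi(n) / d because d <= 1; the others telescope through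
    [coef_primitive], whose value at n is 2 psi(n) / d. *)
Lemma tail_sum_le (alpha0 : 0 < alpha) (r0 : 0 < r) (r1 : r < 1) (n0 : (0 < n)%N) :
  d <= 216^-1 -> 216 <= alpha * r * n%:R `^ r ->
  forall m, \sum_(n <= k < m) psi k <= 3 * psi n / d.
Proof.
move=> d1 nd m; set A := coef alpha r n%:R.
have A0 : 0 < A by exact: coef_gt0.
have a0 : 0 < alpha * r by rewrite mulr_gt0.
have nR : 0 < n%:R :> R by rewrite ltr0n.
have q0 : 0 < n%:R `^ (1 - r) :> R by rewrite powR_gt0.
have d0 : 0 < d by rewrite divr_gt0.
pose W := fun k : nat => coef_primitive alpha r k%:R.
have W0 k : (0 < k)%N -> 0 < W k.
  move=> k0; have kR : 0 < k%:R :> R by rewrite ltr0n.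
  apply: mulr_gt0; last exact: coef_gt0.
  by apply: mulr_gt0; [exact: divr_gt0|exact: powR_gt0].
have Wn : W n = 2 * A / d.
  by rewrite /W /coef_primitive -/A; field; rewrite !gt_eqF.
have Ad : A <= A / d.
  by rewrite ler_pdivlMr// ler_piMr//; [exact: ltW|lra].
have [mn|nm] := leqP m n.
  by rewrite big_geq// divr_ge0 ?mulr_ge0// ltW.
suff H j : \sum_(n <= k < (n + j).+1) psi k <= A + W n - W (n + j)%N.
  have := H (m - n.+1)%N; rewrite -addnS subnSK// subnKC ?(ltnW nm)//.
  have := W0 (n + (m - n.+1))%N (ltn_addr _ n0); rewrite Wn => w0 {}H.
  apply: (le_trans H); have -> : 3 * A / d = A / d + 2 * A / d by ring.
  by clear -w0 Ad; lra.
elim: j => [|j IH]; first by rewrite addn0 big_nat1 addrK.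
have nj1 : (n <= (n + j).+1)%N by rewrite leqW// leq_addr.
rewrite addnS (big_nat_recr _ _ _ nj1).
have nj0 : 0 < (n + j)%:R :> R by rewrite ltr0n addn_gt0 n0.
have nj : 2 <= alpha * r * (n + j)%:R `^ r.
  apply: (@le_trans _ _ (alpha * r * n%:R `^ r)); first by lra.
  by rewrite ler_pM2l//; apply: ler_powR_base; rewrite ?ler0n// ler_nat leq_addr.
have := coef_le_primitive_diff _ _ (n + j)%:R alpha0 r0 r1 nj0 nj.
rewrite natr1 -/(W (n + j)%N) -/(W (n + j).+1).
move=> H; apply: (le_trans (lerD IH H)).
by rewrite addrA subrK.
Qed.

(** Monotonicity and convexity of psi both come from [coef_diff_bounds], and psi(n) - psi(n+1) is at
    most the slope at n, which equals psi(n) d. *)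
Lemma tail_oscillating (alpha0 : 0 < alpha) (r0 : 0 < r) (r1 : r < 1) (n0 : (0 < n)%N) b :
  d <= 216^-1 -> 216 <= alpha * r * n%:R `^ r ->
  oscillating_kernel (cos_tail psi b n) (psi n) d (n%:R - 2^-1)
    (pi / (n%:R - 2^-1)) b.
Proof.
move=> d1 nd.
have psi0 k : 0 <= psi k by exact/ltW/coef_gt0.
have nR : 1 <= n%:R :> R by rewrite ler1n.
have n0R : 0 < n%:R :> R by rewrite ltr0n.
have N0 : 0 < n%:R - 2^-1 :> R by lra.
have a0 : 0 < alpha * r by rewrite mulr_gt0.
have q0 : 0 < n%:R `^ (1 - r) :> R by rewrite powR_gt0.
have B := tail_sum_le alpha0 r0 r1 n0 d1 nd.
have diff k : (n <= k)%N -> coef_slope alpha r k.+1%:R <= psi k - psi k.+1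
    <= coef_slope alpha r k%:R.
  move=> nk; have k0 : 0 < k%:R :> R by rewrite ltr0n (leq_trans n0).
  by have := coef_diff_bounds _ _ _ alpha0 r0 r1 k0; rewrite natr1.
have slope0 k : (n <= k)%N -> 0 < coef_slope alpha r k%:R.
  by move=> nk; apply: coef_slope_gt0 => //; rewrite ltr0n (leq_trans n0).
split.
- exact: coef_gt0.
- by rewrite divr_gt0.
- by [].
- by rewrite divr_gt0// pi_gt0.
(* This is alpha r n^r >= 216 rewritten. As pi < 4, the bound on [h] then follows from 96 n <= 216
   (n - 1/2). *)
- have dn : 216 / n%:R <= d.
    rewrite ler_pdivrMr// (_ : d * n%:R = alpha * r * n%:R `^ r)//.
    have uv : n%:R `^ r * n%:R `^ (1 - r) = n%:R :> R.
      rewrite -powRD; last by rewrite (gt_eqF n0R) implybT.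
      by rewrite addrC subrK powRr1// ltW.
    by rewrite -[X in _ * X = _]uv mulrCA divfK ?gt_eqF// mulrC.
  apply: le_trans dn; rewrite mulrA ler_pdivrMr// mulrAC ler_pdivlMr//.
  have p4 := @pi_lt4 R; set (p := @pi R) in *; clearbody p.
  apply: (@le_trans _ _ (96 * n%:R)); last by lra.
  by rewrite ler_pM2r//; lra.
- by rewrite mulrC divfK// gt_eqF.
- by move=> t; apply: (cos_tail_norm_le _ _ _ _ _ n0 psi0 B).
- move=> t t0pi.
  apply: (le_trans (cos_tail_main psi b n _ t n0 psi0 B _ _ t0pi)).
  + by move=> k nk; have /andP[+ _] := diff k nk; exact/le_trans/(ltW (slope0 k.+1 (leqW nk))).
  + move=> k nk; have /andP[H1 _] := diff k nk.
    by have /andP[_ H2] := diff k.+1 (leqW nk); exact: le_trans H2 H1.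
  + have /andP[t0 _] := t0pi.
    rewrite ler_pM2r ?invr_gt0 ?exprn_gt0// ler_pM2l//.
    have /andP[_ H] := diff n (leqnn n); apply: (le_trans H).
    rewrite /coef_slope -(opprB 1) powRN mulrC.
    by [].
Qed.

End exponential_tail.

(** * Integrals of bounded measurable functions *)

Section bounded_measurable.
Context {R : realType}.
Notation mu := (@lebesgue_measure R).
Variables (a b : R).
Notation D := `[a, b].
Implicit Types f g : R -> R.

(** An algebra that contains both the continuous kernels and the step functions, so that
    integrability is settled once for all products and sums. *)
Definition bounded_measurable f :=
  measurable_fun [set: R] f /\ exists K, forall t, t \in D -> `|f t| <= K.

Lemma bounded_measurable_integrable f :
  bounded_measurable f -> mu.-integrable [set` D] (EFin \o f).
Proof.
move=> [mf [K fK]]; apply: measurable_bounded_integrable => //.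
- by rewrite /= lebesgue_measure_itv/=; case: ifP => _; rewrite ?ltry// -EFinB ltry.
- exact: measurable_funS mf.
- exists K; split; first exact: num_real.
  by move=> M KM t /= tD; apply: (le_trans (fK t tD)); exact: ltW.
Qed.

Lemma bounded_measurable_continuous f : continuous f -> bounded_measurable f.
Proof.
move=> cf; split; first exact: continuous_measurable_fun.
have [M [_ HM]] := compact_bounded
  (continuous_compact (continuous_subspaceT cf) (@segment_compact R a b)).
exists (M + 1) => t tD; apply: (HM (M + 1)); first by rewrite ltrDl.
by exists t.
Qed.

Lemma bounded_measurableM f g : bounded_measurable f -> bounded_measurable g ->
  bounded_measurable (fun t => f t * g t).
Proof.
move=> [mf [K fK]] [mg [L gL]]; split; first exact: measurable_funM.
exists (K * L) => t tD; rewrite normrM ler_pM//; [exact: fK|exact: gL].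
Qed.

Lemma bounded_measurableD f g : bounded_measurable f -> bounded_measurable g ->
  bounded_measurable (fun t => f t + g t).
Proof.
move=> [mf [K fK]] [mg [L gL]]; split; first exact: measurable_funD.
by exists (K + L) => t tD; rewrite (le_trans (ler_normD _ _))// lerD// ?fK ?gL.
Qed.

Lemma bounded_measurable_cst (c : R) : bounded_measurable (fun=> c).
Proof. by split; [exact: measurable_cst|exists `|c|]. Qed.

Lemma bounded_measurable_sum (I : Type) (s : seq I) (F : I -> R -> R) :
  (forall i, bounded_measurable (F i)) ->
  bounded_measurable (fun t => \sum_(i <- s) F i t).
Proof.
move=> bF; elim: s => [|i s IH].
  rewrite (_ : (fun t => _) = fun=> 0); first exact: bounded_measurable_cst.
  by apply/funext => t; rewrite big_nil.
rewrite (_ : (fun t => _) = (fun t => F i t + \sum_(j <- s) F j t)).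
  by apply: bounded_measurableD; [exact: bF|exact: IH].
by apply/funext => t; rewrite big_cons.
Qed.

Lemma Rintegral_bmD f g : bounded_measurable f -> bounded_measurable g ->
  \int[mu]_(t in [set` D]) (f t + g t) =
  \int[mu]_(t in [set` D]) f t + \int[mu]_(t in [set` D]) g t.
Proof. by move=> bf bg; apply: RintegralD => //; exact: bounded_measurable_integrable. Qed.

Lemma Rintegral_bmZ (c : R) f : bounded_measurable f ->
  \int[mu]_(t in [set` D]) (c * f t) = c * \int[mu]_(t in [set` D]) f t.
Proof. by move=> bf; apply: RintegralZl => //; exact: bounded_measurable_integrable. Qed.

Lemma Rintegral_bm_sum (I : Type) (s : seq I) (F : I -> R -> R) :
  (forall i, bounded_measurable (F i)) ->
  \int[mu]_(t in [set` D]) (\sum_(i <- s) F i t) =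
  \sum_(i <- s) \int[mu]_(t in [set` D]) F i t.
Proof.
move=> bF; elim: s => [|i s IH].
  under eq_Rintegral do rewrite big_nil.
  by rewrite big_nil Rintegral_cst// mul0r.
rewrite big_cons -IH -Rintegral_bmD; [|exact: bF|exact: bounded_measurable_sum].
by apply: eq_Rintegral => t _; rewrite big_cons.
Qed.

Lemma le_Rintegral_bm f g : bounded_measurable f -> bounded_measurable g ->
  (forall t, t \in D -> f t <= g t) ->
  \int[mu]_(t in [set` D]) f t <= \int[mu]_(t in [set` D]) g t.
Proof.
by move=> bf bg fg; apply: le_Rintegral => //; exact: bounded_measurable_integrable.
Qed.

Lemma bounded_measurable_norm f : bounded_measurable f ->
  bounded_measurable (fun t => `|f t|).
Proof.
move=> [mf [K fK]]; split; first exact: measurableT_comp.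
by exists K => t tD; rewrite normr_id; exact: fK.
Qed.

Lemma norm_Rintegral_le f g : bounded_measurable f -> bounded_measurable g ->
  (forall t, t \in D -> `|f t| <= g t) ->
  `|\int[mu]_(t in [set` D]) f t| <= \int[mu]_(t in [set` D]) g t.
Proof.
move=> bf bg fg; apply: (le_trans (le_normr_Rintegral _ _)) => //.
  exact: bounded_measurable_integrable.
by apply: le_Rintegral_bm => //; exact: bounded_measurable_norm.
Qed.

Lemma norm_Rintegral_le_cst f (c : R) : a <= b -> bounded_measurable f ->
  (forall t, t \in D -> `|f t| <= c) ->
  `|\int[mu]_(t in [set` D]) f t| <= c * (b - a).
Proof.
move=> ab bf fc.
have -> : c * (b - a) = \int[mu]_(t in [set` D]) c.
  rewrite Rintegral_cst//= lebesgue_measure_itv/= lte_fin.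
  case: ltP => [_ //|ba].
  by rewrite (_ : b = a) ?subrr//; apply/eqP; rewrite eq_le ba.
by apply: norm_Rintegral_le => //; exact: bounded_measurable_cst.
Qed.

(** The class bounds [phi] only essentially; truncation to [-1, 1] alters it on a null set and
    yields a pointwise bound without changing any integral against a continuous function. *)
Lemma ae_clamp (phi : R -> R) : measurable_fun [set: R] phi ->
  {ae mu, forall t, `|phi t| <= 1} ->
  exists phi' : R -> R, [/\ measurable_fun [set: R] phi',
    forall t, `|phi' t| <= 1 &
    forall g, continuous g ->
    \int[mu]_(t in [set` D]) (g t * phi t) = \int[mu]_(t in [set` D]) (g t * phi' t)].
Proof.
move=> mphi phi1.
exists (fun t => Num.max (-1) (Num.min 1 (phi t))).
have mphi' : measurable_fun [set: R] (fun t => Num.max (-1) (Num.min 1 (phi t))).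
  by apply: measurable_maxr; [exact: measurable_cst|apply: measurable_minr].
split => //.
  move=> t; rewrite ler_norml le_max lexx/= ge_max ge_min lexx/=.
  by rewrite andbT; lra.
move=> g cg; congr fine.
have mg := continuous_measurable_fun cg.
apply: ae_eq_integral => //.
- by apply/measurable_EFinP/(measurable_funS measurableT) => //; exact: measurable_funM.
- by apply/measurable_EFinP/(measurable_funS measurableT) => //; exact: measurable_funM.
apply: filterS phi1; first exact: (ae_filter_ringOfSetsType mu).
move=> t; rewrite ler_norml => /andP[t1 t2] _.
by rewrite min_r// max_r.
Qed.

End bounded_measurable.

(** * Fourier coefficients *)

Section trigonometric_polynomials.
Context {R : realType}.
Notation mu := (@lebesgue_measure R).
Notation D := [set` `[- (pi : R), pi]].
Implicit Types f g : R -> R.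

Let Npi_le_pi : - pi <= pi :> R.
Proof. by have := pi_ge0 R; lra. Qed.

Lemma sin_int_pi (z : int) : sin (z%:~R * pi) = 0 :> R.
Proof.
have sn (k : nat) : sin (k%:R * pi) = 0 :> R.
  elim: k => [|k IH]; first by rewrite mul0r sin0.
  by rewrite -natr1 mulrDl mul1r sinDpi IH oppr0.
case: z => k; first exact: sn.
by rewrite NegzE rmorphN/= -pmulrn mulNr sinN sn oppr0.
Qed.

Lemma is_derive_sin_affine (z t : R) : is_derive t 1 (fun t => sin (z * t)) (z * cos (z * t)).
Proof.
have D1 := is_deriveZ z (is_derive_id t (1 : R)).
have := @is_derive1_comp _ sin (z *: id) t _ _ (is_derive_sin (z * t)) D1.
by rewrite /GRing.scale/= mulr1 mulrC.
Qed.

Lemma is_derive_cos_affine (z t : R) :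
  is_derive t 1 (fun t => cos (z * t)) (- z * sin (z * t)).
Proof.
have D1 := is_deriveZ z (is_derive_id t (1 : R)).
have := @is_derive1_comp _ cos (z *: id) t _ _ (is_derive_cos (z * t)) D1.
by rewrite /GRing.scale/= mulr1 mulrC mulrN mulNr.
Qed.

Lemma continuous_cosM (z : R) : continuous (fun t => cos (z * t)).
Proof. by move=> t; apply: is_derive_continuous (is_derive_cos_affine z t). Qed.

Lemma continuous_sinM (z : R) : continuous (fun t => sin (z * t)).
Proof. by move=> t; apply: is_derive_continuous (is_derive_sin_affine z t). Qed.

Lemma Rintegral_cos_int (z : int) : z != 0 ->
  \int[mu]_(t in D) cos (z%:~R * t) = 0.
Proof.
move=> z0; have z0R : z%:~R != 0 :> R by rewrite intr_eq0.
have dF (t : R) : is_derive t 1 (fun t => z%:~R^-1 * sin (z%:~R * t)) (cos (z%:~R * t)).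
  have := is_deriveZ (z%:~R^-1) (is_derive_sin_affine z%:~R t).
  by rewrite /GRing.scale/= mulKf.
rewrite (Rintegral_increment _ _ _ _ Npi_le_pi (continuous_cosM _) dF).
by rewrite mulrN sinN sin_int_pi oppr0 !mulr0 subrr.
Qed.

Lemma Rintegral_sin_int (z : int) : \int[mu]_(t in D) sin (z%:~R * t) = 0.
Proof.
have [->|z0] := eqVneq z 0.
  under eq_Rintegral do rewrite mul0r sin0.
  by rewrite Rintegral_cst// mul0r.
have z0R : z%:~R != 0 :> R by rewrite intr_eq0.
have dF (t : R) : is_derive t 1 (fun t => - z%:~R^-1 * cos (z%:~R * t)) (sin (z%:~R * t)).
  have := is_deriveZ (- z%:~R^-1) (is_derive_cos_affine z%:~R t).
  by rewrite /GRing.scale/= mulrA mulrNN mulVf// mul1r.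
rewrite (Rintegral_increment _ _ _ _ Npi_le_pi (continuous_sinM _) dF).
by rewrite mulrN cosN subrr.
Qed.

Lemma Rintegral_pi_cst (c : R) : \int[mu]_(t in D) c = c * (pi *+ 2).
Proof.
rewrite Rintegral_cst//= lebesgue_measure_itv/= lte_fin ifT ?opprK ?mulr2n//.
by have := pi_gt0 R; lra.
Qed.

Let bmc z : bounded_measurable (- pi) pi (fun t : R => cos (z * t)).
Proof. by apply: bounded_measurable_continuous; exact: continuous_cosM. Qed.

Let bms z : bounded_measurable (- pi) pi (fun t : R => sin (z * t)).
Proof. by apply: bounded_measurable_continuous; exact: continuous_sinM. Qed.

Lemma Rintegral_cos_cos (j k : nat) : (0 < k)%N ->
  \int[mu]_(t in D) (cos (k%:R * t) * cos (j%:R * t)) = if k == j then pi else 0.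
Proof.
move=> k0; pose zm : int := k%:Z - j%:Z; pose zp : int := k%:Z + j%:Z.
transitivity (\int[mu]_(t in D) (2^-1 * cos (zm%:~R * t) + 2^-1 * cos (zp%:~R * t))).
  apply: eq_Rintegral => t _.
  by rewrite /zm /zp intrB intrD -!pmulrn mulrBl mulrDl cosB cosD; field.
rewrite Rintegral_bmD; [|by apply: bounded_measurableM => //; exact: bounded_measurable_cst..].
rewrite !Rintegral_bmZ// [X in _ + _ * X]Rintegral_cos_int ?mulr0 ?addr0; last first.
  by rewrite /zp -PoszD; case: k k0 {zm zp}.
have [kj|kj] := eqVneq k j.
  rewrite /zm kj subrr; under eq_Rintegral do rewrite mul0r cos0.
  by rewrite Rintegral_pi_cst mul1r -[pi *+ 2]mulr_natr mulrCA mulVf ?mulr1.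
by rewrite Rintegral_cos_int ?mulr0// /zm subr_eq0.
Qed.

Lemma Rintegral_sin_sin (j k : nat) : (0 < k)%N ->
  \int[mu]_(t in D) (sin (k%:R * t) * sin (j%:R * t)) = if k == j then pi else 0.
Proof.
move=> k0; pose zm : int := k%:Z - j%:Z; pose zp : int := k%:Z + j%:Z.
transitivity (\int[mu]_(t in D) (2^-1 * cos (zm%:~R * t) + (- 2^-1) * cos (zp%:~R * t))).
  apply: eq_Rintegral => t _.
  by rewrite /zm /zp intrB intrD -!pmulrn mulrBl mulrDl cosB cosD; field.
rewrite Rintegral_bmD; [|by apply: bounded_measurableM => //; exact: bounded_measurable_cst..].
rewrite !Rintegral_bmZ// [X in _ + _ * X]Rintegral_cos_int ?mulr0 ?addr0; last first.
  by rewrite /zp -PoszD; case: k k0 {zm zp}.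
have [kj|kj] := eqVneq k j.
  rewrite /zm kj subrr; under eq_Rintegral do rewrite mul0r cos0.
  by rewrite Rintegral_pi_cst mul1r -[pi *+ 2]mulr_natr mulrCA mulVf ?mulr1.
by rewrite Rintegral_cos_int ?mulr0// /zm subr_eq0.
Qed.

Lemma Rintegral_sin_cos (j k : nat) :
  \int[mu]_(t in D) (sin (k%:R * t) * cos (j%:R * t)) = 0.
Proof.
pose zm : int := k%:Z - j%:Z; pose zp : int := k%:Z + j%:Z.
transitivity (\int[mu]_(t in D) (2^-1 * sin (zm%:~R * t) + 2^-1 * sin (zp%:~R * t))).
  apply: eq_Rintegral => t _.
  by rewrite /zm /zp intrB intrD -!pmulrn mulrBl mulrDl sinB sinD; field.
rewrite Rintegral_bmD; [|by apply: bounded_measurableM => //; exact: bounded_measurable_cst..].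
by rewrite !Rintegral_bmZ// !Rintegral_sin_int !mulr0 addr0.
Qed.

Definition trig_poly (a0 : R) (A B : R^nat) (m : nat) (x : R) : R :=
  a0 / 2 + \sum_(1 <= k < m.+1) (A k * cos (k%:R * x) + B k * sin (k%:R * x)).

Lemma continuous_trig_poly a0 A B m : continuous (trig_poly a0 A B m).
Proof.
move=> x; apply: cvgD; first exact: cvg_cst.
apply: continuous_sumR => k t; apply: cvgD; apply: cvgM; try exact: cvg_cst.
  exact: continuous_cosM.
exact: continuous_sinM.
Qed.

Lemma Rintegral_trig_poly a0 A B m g : continuous g ->
  \int[mu]_(t in D) (trig_poly a0 A B m t * g t) =
  a0 / 2 * \int[mu]_(t in D) g t +
  \sum_(1 <= k < m.+1) (A k * \int[mu]_(t in D) (cos (k%:R * t) * g t) +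
                        B k * \int[mu]_(t in D) (sin (k%:R * t) * g t)).
Proof.
move=> cg.
have bg : bounded_measurable (- pi) pi g by exact: bounded_measurable_continuous.
have bZ c h : bounded_measurable (- pi) pi h -> bounded_measurable (- pi) pi (fun t : R => c * h t).
  by move=> bh; apply: bounded_measurableM => //; exact: bounded_measurable_cst.
have bcg k : bounded_measurable (- pi) pi (fun t => cos (k%:R * t) * g t).
  exact: bounded_measurableM.
have bsg k : bounded_measurable (- pi) pi (fun t => sin (k%:R * t) * g t).
  exact: bounded_measurableM.
pose F k t := A k * (cos (k%:R * t) * g t) + B k * (sin (k%:R * t) * g t).
have bF k : bounded_measurable (- pi) pi (F k).
  by apply: bounded_measurableD; exact: bZ.
transitivity (\int[mu]_(t in D) (a0 / 2 * g t + \sum_(1 <= k < m.+1) F k t)).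
  apply: eq_Rintegral => t _; rewrite /trig_poly mulrDl big_distrl/=; congr (_ + _).
  by apply: eq_bigr => k _; rewrite /F mulrDl !mulrA.
rewrite Rintegral_bmD; [|exact: bZ|exact: bounded_measurable_sum].
rewrite Rintegral_bmZ// Rintegral_bm_sum//; congr (_ + _).
by apply: eq_bigr => k _; rewrite /F Rintegral_bmD ?Rintegral_bmZ//; exact: bZ.
Qed.

Lemma fourier_cos_trig_poly0 a0 A B m : fourier_cos (trig_poly a0 A B m) 0 = a0.
Proof.
have p0 : pi != 0 :> R by rewrite gt_eqF// pi_gt0.
rewrite /fourier_cos Rintegral_trig_poly; last exact: continuous_cosM.
rewrite big1_seq ?addr0; last first.
  move=> k /=; rewrite mem_index_iota => /andP[k0 _].
  by rewrite Rintegral_cos_cos// Rintegral_sin_cos gtn_eqF// !mulr0 addr0.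
under eq_Rintegral do rewrite mul0r cos0.
rewrite Rintegral_pi_cst mul1r.
by move: (pi : R) p0 => p p0; field.
Qed.

Lemma fourier_cos_trig_poly a0 A B m j : (0 < j <= m)%N ->
  fourier_cos (trig_poly a0 A B m) j = A j.
Proof.
move=> /andP[j0 jm]; have p0 : pi != 0 :> R by rewrite gt_eqF// pi_gt0.
rewrite /fourier_cos Rintegral_trig_poly; last exact: continuous_cosM.
have := @Rintegral_cos_int j%:Z; rewrite -pmulrn => ->; last by rewrite -lt0n.
rewrite mulr0 add0r (bigD1_seq j)/= ?iota_uniq//; last by rewrite mem_index_iota j0.
rewrite big1_seq ?addr0.
  by rewrite Rintegral_cos_cos// eqxx Rintegral_sin_cos mulr0 addr0 mulrC mulfK.
move=> k /andP[kj]; rewrite mem_index_iota => /andP[k0 _].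
by rewrite Rintegral_cos_cos// (negbTE kj) Rintegral_sin_cos !mulr0 addr0.
Qed.

Lemma fourier_sin_trig_poly a0 A B m j : (0 < j <= m)%N ->
  fourier_sin (trig_poly a0 A B m) j = B j.
Proof.
move=> /andP[j0 jm]; have p0 : pi != 0 :> R by rewrite gt_eqF// pi_gt0.
rewrite /fourier_sin Rintegral_trig_poly; last exact: continuous_sinM.
have := @Rintegral_sin_int j%:Z; rewrite -pmulrn => ->.
have sc k : \int[mu]_(t in D) (cos (k%:R * t) * sin (j%:R * t)) = 0.
  by rewrite -[RHS](Rintegral_sin_cos k j); apply: eq_Rintegral => t _; rewrite mulrC.
rewrite mulr0 add0r (bigD1_seq j)/= ?iota_uniq//; last by rewrite mem_index_iota j0.
rewrite big1_seq ?addr0.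
  by rewrite Rintegral_sin_sin// eqxx sc mulr0 add0r mulrC mulfK.
move=> k /andP[kj]; rewrite mem_index_iota => /andP[k0 _].
by rewrite Rintegral_sin_sin// (negbTE kj) sc !mulr0 addr0.
Qed.

(** Replacing [f] by [U M] changes the integral by at most 2 pi [e M], hence the coefficient by at
    most [2 * e M], and the coefficient of [U M] is eventually constant. *)
Lemma coefficient_uniform_limit f U (e : R^nat) (c : R) g (m : nat) :
  (forall M x, `|f x - U M x| <= e M) -> e @ \oo --> 0 ->
  continuous f -> (forall M, continuous (U M)) ->
  continuous g -> (forall t, `|g t| <= 1) ->
  (forall M, (m <= M)%N -> pi^-1 * \int[mu]_(t in D) (U M t * g t) = c) ->
  pi^-1 * \int[mu]_(t in D) (f t * g t) = c.
Proof.
move=> fU e0 cf cU cg g1 Uc; apply/eqP; rewrite -subr_eq0 -normr_le0.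
have E0 : (fun M => 2 * e M) @ \oo --> 0.
  by rewrite -(mulr0 2); apply: cvgM => //; exact: cvg_cst.
apply: (le_of_cvg0 _ _ _ m E0) => M mM; rewrite add0r -(Uc M mM) -mulrBr.
have p0 := pi_gt0 R.
have bg : bounded_measurable (- pi) pi g by exact: bounded_measurable_continuous.
have bU : bounded_measurable (- pi) pi (U M) by exact: bounded_measurable_continuous.
have bf : bounded_measurable (- pi) pi f by exact: bounded_measurable_continuous.
have -> : \int[mu]_(t in D) (f t * g t) - \int[mu]_(t in D) (U M t * g t) =
    \int[mu]_(t in D) (f t * g t + (-1) * (U M t * g t)).
  rewrite Rintegral_bmD ?Rintegral_bmZ ?mulN1r//; do ?exact: bounded_measurableM.
  apply: bounded_measurableM; first exact: bounded_measurable_cst.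
  exact: bounded_measurableM.
rewrite normrM gtr0_norm ?invr_gt0// ler_pdivrMl//.
have -> : pi * (2 * e M) = e M * (pi - - pi) by ring.
apply: norm_Rintegral_le_cst => //.
  apply: bounded_measurableD; first exact: bounded_measurableM.
  apply: bounded_measurableM; first exact: bounded_measurable_cst.
  exact: bounded_measurableM.
move=> t _; rewrite mulN1r -mulrBl normrM.
by rewrite -[leRHS]mulr1; apply: ler_pM.
Qed.

(** Takes the place of Fubini's theorem for the coefficients of a convolution: they are read off
    from truncations, which are trigonometric polynomials with known coefficients. *)
Lemma fourier_sum_uniform_limit f (a0 : R) (A B e : R^nat) :
  (forall M x, `|f x - trig_poly a0 A B M x| <= e M) -> e @ \oo --> 0 ->
  forall m, fourier_sum f m =1 trig_poly a0 A B m.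
Proof.
move=> fU e0 m x.
have cU := continuous_trig_poly a0 A B.
have cf : continuous f by exact: uniform_limit_continuousR fU e0 cU.
have C0 : fourier_cos f 0 = a0.
  apply: (coefficient_uniform_limit _ _ _ _ _ 0 fU e0 cf cU (continuous_cosM _)).
    by move=> t; exact: cos_max.
  by move=> M _; exact: fourier_cos_trig_poly0.
rewrite /fourier_sum /trig_poly C0; congr (_ + _).
apply: eq_big_nat => k /andP[k0 _]; congr (_ * _ + _ * _).
- apply: (coefficient_uniform_limit _ _ _ _ _ k fU e0 cf cU (continuous_cosM _)).
    by move=> t; exact: cos_max.
  by move=> M kM; apply: fourier_cos_trig_poly; rewrite k0.
- apply: (coefficient_uniform_limit _ _ _ _ _ k fU e0 cf cU (continuous_sinM _)).
    by move=> t; exact: sin_max.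
  by move=> M kM; apply: fourier_sin_trig_poly; rewrite k0.
Qed.

End trigonometric_polynomials.

(** * The remainder of the Fourier sum as a convolution *)

Section remainder.
Context {R : realType}.
Notation mu := (@lebesgue_measure R).
Notation D := [set` `[- (pi : R), pi]].
Implicit Types (psi : R^nat) (phi : R -> R).

Lemma continuous_reflect (f : R -> R) (x : R) : continuous f ->
  continuous (fun t => f (x - t)).
Proof.
move=> cf t; apply: (@continuous_comp R R R (fun t => x - t) f); last exact: cf.
by apply: cvgB; [exact: cvg_cst|exact: cvg_id].
Qed.

Lemma continuous_sin_affine (a c : R) : continuous (fun t : R => sin (a * t - c)).
Proof.
move=> t; apply: (@continuous_comp R R R (fun t : R => a * t - c) sin);
  last exact: continuous_sin.
by apply: cvgB; [apply: cvgM; [exact: cvg_cst|exact: cvg_id]|exact: cvg_cst].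
Qed.

Lemma bounded_measurable_unit phi (a b : R) : measurable_fun [set: R] phi ->
  (forall t, `|phi t| <= 1) -> bounded_measurable a b phi.
Proof. by move=> mphi phi1; split => //; exists 1. Qed.

Lemma convolution_cos_sum psi b phi n m x :
  measurable_fun [set: R] phi -> (forall t, `|phi t| <= 1) ->
  pi^-1 * \int[mu]_(t in D) (cos_sum psi b n m (x - t) * phi t) =
  \sum_(n <= k < m)
    (pi^-1 * (psi k * \int[mu]_(t in D) (cos (k%:R * t - - b) * phi t)) * cos (k%:R * x) +
     pi^-1 * (psi k * \int[mu]_(t in D) (sin (k%:R * t - - b) * phi t)) * sin (k%:R * x)).
Proof.
move=> mphi phi1.
have bphi := bounded_measurable_unit _ (- pi) pi mphi phi1.
have bc k : bounded_measurable (- pi) pi (fun t => cos (k%:R * t - - b) * phi t).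
  apply: bounded_measurableM => //; apply: bounded_measurable_continuous.
  exact: continuous_cos_affine.
have bs k : bounded_measurable (- pi) pi (fun t => sin (k%:R * t - - b) * phi t).
  apply: bounded_measurableM => //; apply: bounded_measurable_continuous.
  exact: continuous_sin_affine.
have bZ c h : bounded_measurable (- pi) pi h ->
    bounded_measurable (- pi) pi (fun t : R => c * h t).
  by move=> bh; apply: bounded_measurableM => //; exact: bounded_measurable_cst.
pose F (k : nat) t :=
  psi k * cos (k%:R * x) * (cos (k%:R * t - - b) * phi t) +
  psi k * sin (k%:R * x) * (sin (k%:R * t - - b) * phi t).
have bF k : bounded_measurable (- pi) pi (F k).
  by apply: bounded_measurableD; exact: bZ.
transitivity (pi^-1 * \int[mu]_(t in D) \sum_(n <= k < m) F k t).
  congr (_ * _); apply: eq_Rintegral => t _; rewrite /cos_sum big_distrl/=.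
  apply: eq_bigr => k _; rewrite /F.
  have -> : k%:R * (x - t) - b = k%:R * x - (k%:R * t - - b) by ring.
  by rewrite cosB; ring.
rewrite Rintegral_bm_sum// big_distrr/=; apply: eq_bigr => k _.
rewrite /F Rintegral_bmD ?Rintegral_bmZ//; [|exact: bZ|exact: bZ].
by rewrite mulrDr; congr (_ + _); rewrite -!mulrA; congr (_ * (_ * _)); rewrite mulrC.
Qed.

(** Convolving [phi] with truncated kernels gives trigonometric polynomials that converge uniformly
    to [f]. Hence the Fourier sum of order [n.-1] is the convolution with [cos_sum psi b 1 n], up to
    the constant term, and subtraction leaves the tail. *)
Lemma remainder_formula psi b n B phi (a0 : R) (f : R -> R) :
  (0 < n)%N -> (forall k, 0 <= psi k) ->
  (forall m, \sum_(n <= k < m) psi k <= B) ->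
  measurable_fun [set: R] phi -> (forall t, `|phi t| <= 1) ->
  (forall x, f x = a0 / 2 + pi^-1 * \int[mu]_(t in D) (cos_series psi b (x - t) * phi t)) ->
  forall x, f x - fourier_sum f n.-1 x =
    pi^-1 * \int[mu]_(t in D) (cos_tail psi b n (x - t) * phi t).
Proof.
move=> n0 p0 pB mphi phi1 fE.
have bphi := bounded_measurable_unit _ (- pi) pi mphi phi1.
have cK := continuous_cos_series psi b n B p0 pB.
have bK x : bounded_measurable (- pi) pi (fun t => cos_series psi b (x - t) * phi t).
  apply: bounded_measurableM => //; apply: bounded_measurable_continuous.
  exact: continuous_reflect.
have bS k m x : bounded_measurable (- pi) pi (fun t => cos_sum psi b k m (x - t) * phi t).
  apply: bounded_measurableM => //; apply: bounded_measurable_continuous.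
  exact/continuous_reflect/continuous_cos_sum.
pose A k := pi^-1 * (psi k * \int[mu]_(t in D) (cos (k%:R * t - - b) * phi t)).
pose C k := pi^-1 * (psi k * \int[mu]_(t in D) (sin (k%:R * t - - b) * phi t)).
have sub m x : f x - trig_poly a0 A C m x = pi^-1 * \int[mu]_(t in D)
    ((cos_series psi b (x - t) - cos_sum psi b 1 m.+1 (x - t)) * phi t).
  rewrite fE /trig_poly -convolution_cos_sum//.
  have -> (u v w : R) : u + v - (u + w) = v - w by ring.
  rewrite -mulrBr -RintegralB//; do ?exact: bounded_measurable_integrable.
  by congr (_ * _); apply: eq_Rintegral => t _; rewrite mulrBl.
have [e e0 He] := cos_series_dist psi b n B p0 pB.
have E0 : (fun M => 2 * e M) @ \oo --> 0.
  by rewrite -(mulr0 2); apply: cvgM => //; exact: cvg_cst.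
have fU M x : `|f x - trig_poly a0 A C M x| <= 2 * e M.
  have pi0 := pi_gt0 R.
  rewrite sub normrM gtr0_norm ?invr_gt0// ler_pdivrMl//.
  have -> : pi * (2 * e M) = e M * (pi - - pi) by ring.
  apply: norm_Rintegral_le_cst; first by lra.
    apply: bounded_measurableM => //; apply: bounded_measurable_continuous.
    apply: (continuous_reflect (fun y => cos_series psi b y - cos_sum psi b 1 M.+1 y)) => y.
    by apply: cvgB; [exact: cK|exact: continuous_cos_sum].
  move=> t _; rewrite normrM -[leRHS]mulr1; apply: ler_pM => //; exact: He.
move=> x; rewrite (fourier_sum_uniform_limit _ _ _ _ _ fU E0) sub.
by rewrite prednK.
Qed.

Lemma remainder_norm_le psi b n B phi G :
  (0 < n)%N -> (forall k, 0 <= psi k) ->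
  (forall m, \sum_(n <= k < m) psi k <= B) ->
  measurable_fun [set: R] phi -> (forall t, `|phi t| <= 1) ->
  (forall x : R, is_derive x 1 G `|cos_tail psi b n x|) ->
  forall x, `|\int[mu]_(t in D) (cos_tail psi b n (x - t) * phi t)| <= G pi - G (- pi).
Proof.
move=> n0 p0 pB mphi phi1 dG x.
have bphi := bounded_measurable_unit _ (- pi) pi mphi phi1.
have cq := continuous_cos_tail psi b n B p0 pB.
have cqx : continuous (fun t => cos_tail psi b n (x - t)) by exact: continuous_reflect.
have cnq : continuous (fun t => `|cos_tail psi b n (x - t)|).
  by move=> t; apply: cvg_norm; exact: cqx.
have pi0 := pi_ge0 R.
have dGx (t : R) : is_derive t 1 (fun t => - G (x - t)) `|cos_tail psi b n (x - t)|.
  have D1 : is_derive t 1 (cst x - id) (-1 : R).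
    by apply: is_derive_eq; rewrite sub0r.
  have D2 := @is_derive1_comp _ G (cst x - id) t _ _ (dG (x - t)) D1.
  by have := is_deriveN D2; rewrite mulrN1 opprK.
apply: (@le_trans _ _ (\int[mu]_(t in D) `|cos_tail psi b n (x - t)|)).
  apply: norm_Rintegral_le.
  - by apply: bounded_measurableM => //; exact: bounded_measurable_continuous.
  - exact: bounded_measurable_continuous.
  - by move=> t _; rewrite normrM ler_piMr.
rewrite (Rintegral_increment _ _ _ _ _ cnq dGx); last by lra.
have per : periodic (fun x => `|cos_tail psi b n x|) (pi *+ 2).
  by move=> u; rewrite /= cos_tail_periodic.
have := periodic_increment G _ _ per dG (x - pi) (- pi).
have -> : - pi + pi *+ 2 = pi :> R by rewrite mulr2n addKr.
have -> : x - pi + pi *+ 2 = x - - pi by rewrite mulr2n; ring.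
by move=> <-; lra.
Qed.

End remainder.

(** * Test functions *)

Section test_function.
Context {R : realType}.
Notation mu := (@lebesgue_measure R).
Notation D := [set` `[- (pi : R), pi]].
Implicit Types (g G : R -> R) (c h u x y t : R).

(** Half-open, so that indicators of adjacent intervals add up exactly. *)
Definition itv_indic x y t : R := \1_([set` `[x, y[]) t.

Lemma itv_indicE x y t : itv_indic x y t = ((x <= t < y)%R : bool)%:R.
Proof. by rewrite /itv_indic indicE mem_setE in_itv. Qed.

Lemma measurable_itv_indic x y : measurable_fun [set: R] (itv_indic x y).
Proof. exact: measurable_indic. Qed.

Lemma itv_indic_ge0 x y t : 0 <= itv_indic x y t.
Proof. by rewrite itv_indicE ler0n. Qed.

Lemma itv_indic_split x y z t : x <= y -> y <= z ->
  itv_indic x z t = itv_indic x y t + itv_indic y z t.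
Proof.
move=> xy yz; rewrite !itv_indicE.
have [xt|tx] /= := leP x t; last by rewrite leNgt (lt_le_trans tx xy)/= addr0.
have [yt|ty] /= := leP y t; first by rewrite add0r.
by rewrite (lt_le_trans ty yz) addr0.
Qed.

Lemma itv_indic_bm (a b : R) x y : bounded_measurable a b (itv_indic x y).
Proof.
split; first exact: measurable_itv_indic.
by exists 1 => t _; rewrite itv_indicE normr_nat lern1; case: (_ && _).
Qed.

Lemma Rintegral_mul_itv_indic g G (a b : R) x y : a <= x -> x <= y -> y <= b ->
  continuous g -> (forall t : R, is_derive t 1 G (g t)) ->
  \int[mu]_(t in `[a, b]) (g t * itv_indic x y t) = G y - G x.
Proof.
move=> ax xy yb cg dG.
transitivity (\int[mu]_(t in `[a, b]) (g \_ `[x, y[) t).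
  apply: eq_Rintegral => t _; rewrite patchE itv_indicE mem_setE in_itv/=.
  by case: ifP => _; rewrite ?mulr1 ?mulr0.
rewrite -Rintegral_mkcondr (_ : `[a, b] `&` `[x, y[ = [set` `[x, y[]); last first.
  apply/seteqP; split => t /=; first by case.
  move=> txy; split => //; move: txy; rewrite !in_itv/= => /andP[xt ty].
  by rewrite (le_trans ax xt)/= (le_trans (ltW ty) yb).
rewrite Rintegral_itv_bndo_bndc ?(Rintegral_increment G)//.
apply: integrableS (continuous_integrable_itv g x y cg) => //.
by apply: subset_itv; rewrite bnd_simp.
Qed.

(** One period of the negated sign of the sine, which has integral zero. *)
Definition pulse c h t := itv_indic (c + h) (c + h + h) t - itv_indic c (c + h) t.

Lemma pulse_bm (a b : R) c h : bounded_measurable a b (pulse c h).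
Proof.
rewrite (_ : pulse c h = fun t => itv_indic (c + h) (c + h + h) t + (-1) * itv_indic c (c + h) t).
  apply: bounded_measurableD; first exact: itv_indic_bm.
  by apply: bounded_measurableM; [exact: bounded_measurable_cst|exact: itv_indic_bm].
by apply/funext => t; rewrite mulN1r.
Qed.

Lemma pulse_norm_le c h t : 0 <= h -> `|pulse c h t| <= itv_indic c (c + h + h) t.
Proof.
move=> h0; rewrite (itv_indic_split c (c + h)) ?lerDl// /pulse.
apply: (le_trans (ler_normB _ _)).
by rewrite !(ger0_norm (itv_indic_ge0 _ _ _)) [leRHS]addrC.
Qed.

Lemma Rintegral_mul_pulse g G (a b : R) c h : 0 <= h -> a <= c -> c + h + h <= b ->
  continuous g -> (forall t : R, is_derive t 1 G (g t)) ->
  \int[mu]_(t in `[a, b]) (g t * pulse c h t) =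
  G (c + h + h) - G (c + h) - (G (c + h) - G c).
Proof.
move=> h0 ac cb cg dG.
have bgi x y : bounded_measurable a b (fun t => g t * itv_indic x y t).
  by apply: bounded_measurableM; [exact: bounded_measurable_continuous|exact: itv_indic_bm].
transitivity (\int[mu]_(t in `[a, b])
  (g t * itv_indic (c + h) (c + h + h) t - g t * itv_indic c (c + h) t)).
  by apply: eq_Rintegral => t _; rewrite mulrBr.
rewrite RintegralB//; do ?exact: bounded_measurable_integrable.
by rewrite !(Rintegral_mul_itv_indic g G)//; lra.
Qed.

Definition pulse_train (c : nat -> R) h (m : nat) t :=
  \sum_(0 <= i < m) pulse (c i) h t.

Lemma pulse_train_bm (a b : R) (c : nat -> R) h m : bounded_measurable a b (pulse_train c h m).
Proof. by apply: bounded_measurable_sum => i; exact: pulse_bm. Qed.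

Lemma Rintegral_mul_pulse_train g G (a b : R) (c : nat -> R) h m : 0 <= h ->
  (forall i, (i < m)%N -> a <= c i /\ c i + h + h <= b) ->
  continuous g -> (forall t : R, is_derive t 1 G (g t)) ->
  \int[mu]_(t in `[a, b]) (g t * pulse_train c h m t) =
  \sum_(0 <= i < m) (G (c i + h + h) - G (c i + h) - (G (c i + h) - G (c i))).
Proof.
move=> h0 cab cg dG.
have bg i : bounded_measurable a b (fun t => g t * pulse (c i) h t).
  by apply: bounded_measurableM; [exact: bounded_measurable_continuous|exact: pulse_bm].
transitivity (\int[mu]_(t in `[a, b]) (\sum_(0 <= i < m) g t * pulse (c i) h t)).
  by apply: eq_Rintegral => t _; rewrite /pulse_train big_distrr.
rewrite Rintegral_bm_sum//; apply: eq_big_nat => i /andP[_ im].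
by have [ac cb] := cab i im; rewrite (Rintegral_mul_pulse g G).
Qed.

Lemma grid_succ u h m : u + h *+ 2 *+ m.+1 = u + h *+ 2 *+ m + h + h.
Proof. by rewrite [_ *+ m.+1]mulrSr [X in _ + (_ + X)]mulr2n !addrA. Qed.

(** Bounding by the indicator of the union of the periods, rather than by 1, records their
    disjointness and makes the induction work. *)
Lemma pulse_train_norm_le u h m t : 0 <= h ->
  `|pulse_train (fun i => u + h *+ 2 *+ i) h m t| <= itv_indic u (u + h *+ 2 *+ m) t.
Proof.
move=> h0; elim: m => [|m IH].
  by rewrite /pulse_train big_geq// normr0 itv_indicE ler0n.
rewrite /pulse_train big_nat_recr//= (le_trans (ler_normD _ _))//.
have h20 : 0 <= h *+ 2 by rewrite mulrn_wge0.
rewrite (itv_indic_split u (u + h *+ 2 *+ m)); last 2 first.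
- by rewrite lerDl mulrn_wge0.
- by rewrite lerD2l ler_wpMn2l.
apply: lerD => //; apply: (le_trans (pulse_norm_le _ _ _ h0)).
by rewrite grid_succ.
Qed.

Lemma pulse_train_reflected_norm_le u h m t : 0 <= h ->
  `|pulse_train (fun i => - (u + h *+ 2 *+ i + h + h)) h m t| <=
  itv_indic (- (u + h *+ 2 *+ m)) (- u) t.
Proof.
move=> h0; elim: m => [|m IH].
  by rewrite /pulse_train big_geq// normr0 itv_indicE ler0n.
rewrite /pulse_train big_nat_recr//= (le_trans (ler_normD _ _))//.
have h20 : 0 <= h *+ 2 by rewrite mulrn_wge0.
rewrite (itv_indic_split _ (- (u + h *+ 2 *+ m))); last 2 first.
- by rewrite lerN2 lerD2l ler_wpMn2l.
- by rewrite lerN2 lerDl mulrn_wge0.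
rewrite addrC; apply: lerD => //; apply: (le_trans (pulse_norm_le _ _ _ h0)).
rewrite (_ : - (u + h *+ 2 *+ m + h + h) + h + h = - (u + h *+ 2 *+ m)); last by ring.
by rewrite grid_succ.
Qed.

(** The argument is reduced modulo [p] by a floor, which is measurable because it is monotone.
    Equality of [f] at the two ends gives agreement on the closed segment, right end included. *)
Lemma exists_periodization (f : R -> R) (a p : R) : 0 < p ->
  measurable_fun [set: R] f -> f a = f (a + p) ->
  exists phi : R -> R, [/\ measurable_fun [set: R] phi, periodic phi p,
    (forall t, exists s, phi t = f s) & forall t, t \in `[a, a + p] -> phi t = f t].
Proof.
move=> p0 mf fap.
pose k (t : R) : int := Num.floor ((t - a) / p).
exists (fun t => f (t - p * (k t)%:~R)); split.
- apply: measurableT_comp => //; apply: measurable_funB => //.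
  apply: measurable_funM; first exact: measurable_cst.
  apply: nondecreasing_measurable => // s t st.
  by rewrite ler_int; apply: le_floor; rewrite ler_pM2r ?invr_gt0// lerB.
- move=> t; rewrite /k (_ : (t + p - a) / p = (t - a) / p + 1%:~R); last first.
    by field; rewrite gt_eqF.
  rewrite floorDrz ?intr_int// intrKfloor intrD; congr f; ring.
- by move=> t; exists (t - p * (k t)%:~R).
move=> t; rewrite in_itv/= => /andP[at_ ta].
move: ta; rewrite le_eqVlt => /predU1P[->|ta].
  rewrite /k (_ : (a + p - a) / p = 1); last by field; rewrite gt_eqF.
  by rewrite floor1 mulr1 addrK.
rewrite /k (_ : Num.floor _ = 0) ?mulr0 ?subr0//.
apply/eqP; rewrite floor_eq divr_ge0 ?subr_ge0// ?(ltW p0)//=.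
by rewrite add0r ltr_pdivrMr// mul1r ltrBlDl.
Qed.

(* The second sum is the first one for the function [t |-> - G (- t)]. *)
Lemma exists_test_function (u1 u2 h : R) (m1 m2 : nat) : 0 < h ->
  0 < u1 -> u1 + h *+ 2 *+ m1 < pi -> 0 < u2 -> u2 + h *+ 2 *+ m2 < pi ->
  exists phi : R -> R, [/\ measurable_fun [set: R] phi, periodic phi (pi *+ 2),
    (forall t, `|phi t| <= 1) &
    forall g G, continuous g -> (forall t : R, is_derive t 1 G (g t)) ->
    \int[mu]_(t in D) (g t * phi t) =
    \sum_(0 <= i < m1) (let v := u1 + h *+ 2 *+ i in
       G (v + h + h) - G (v + h) - (G (v + h) - G v)) +
    \sum_(0 <= i < m2) (let v := u2 + h *+ 2 *+ i in
       - G (- (v + h + h)) - - G (- (v + h)) - (- G (- (v + h)) - - G (- v)))].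
Proof.
move=> h0 u10 u1pi u20 u2pi; have h0' := ltW h0.
pose f1 := pulse_train (fun i => u1 + h *+ 2 *+ i) h m1.
pose f2 := pulse_train (fun i => - (u2 + h *+ 2 *+ i + h + h)) h m2.
(* Reflection exchanges the two halves of a pulse, whence the factor -1. *)
pose f t := f1 t + (-1) * f2 t.
have b1 := fun t => pulse_train_norm_le u1 h m1 t h0'.
have b2 := fun t => pulse_train_reflected_norm_le u2 h m2 t h0'.
have bf a b : bounded_measurable a b f.
  apply: bounded_measurableD; first exact: pulse_train_bm.
  by apply: bounded_measurableM; [exact: bounded_measurable_cst|exact: pulse_train_bm].
have fb t : `|f t| <= itv_indic u1 (u1 + h *+ 2 *+ m1) t +
    itv_indic (- (u2 + h *+ 2 *+ m2)) (- u2) t.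
  by rewrite /f mulN1r (le_trans (ler_normB _ _))//; apply: lerD; [exact: b1|exact: b2].
(* The two trains lie on opposite sides of 0, so at most one indicator is nonzero. *)
have f1b t : `|f t| <= 1.
  apply: (le_trans (fb t)); rewrite !itv_indicE -natrD lern1.
  have [t1|t1] /= := leP u1 t; last by case: (_ && _).
  rewrite (_ : (t < - u2) = false) ?andbF ?addn0; first by case: (_ < _).
  by apply/negbTE; rewrite -leNgt; lra.
(* Both trains stay strictly inside ]-pi, pi[, so [f] vanishes at both ends and can be
   periodized. *)
have fpi : f (- pi) = f (- pi + pi *+ 2).
  have pp : - pi + pi *+ 2 = pi :> R by rewrite mulr2n addKr.
  have fz t : pi <= `|t| -> f t = 0.
    move=> tpi; apply/eqP; rewrite -normr_le0; apply: (le_trans (fb t)).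
    rewrite !itv_indicE -natrD lern0 addn_eq0; apply/andP.
    split; rewrite eqb0; apply/negP => /andP[].
      move=> t1 t2; move: tpi; rewrite ger0_norm; lra.
    move=> t1 t2; move: tpi; rewrite ler0_norm; lra.
  by rewrite pp !fz// ?normrN ger0_norm// pi_ge0.
have pp0 : 0 < pi *+ 2 :> R by rewrite pmulrn_lgt0// pi_gt0.
have [mf _] := bf 0 0.
have [phi [mphi perphi phif phiD]] := exists_periodization f (- pi) (pi *+ 2) pp0 mf fpi.
exists phi; split => //.
  by move=> t; have [s ->] := phif t.
move=> g G cg dG.
have bg : bounded_measurable (- pi) pi g by exact: bounded_measurable_continuous.
have bgf (c : nat -> R) m : bounded_measurable (- pi) pi (fun t => g t * pulse_train c h m t).
  by apply: bounded_measurableM => //; exact: pulse_train_bm.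
transitivity (\int[mu]_(t in D) (g t * f1 t + (-1) * (g t * f2 t))).
  apply: eq_Rintegral => t; rewrite inE => tD.
  rewrite phiD; first by rewrite /f; ring.
  by rewrite mulr2n addKr.
rewrite Rintegral_bmD; [|exact: bgf|]; last first.
  by apply: bounded_measurableM; [exact: bounded_measurable_cst|exact: bgf].
rewrite Rintegral_bmZ; last exact: bgf.
have pi0 := pi_gt0 R.
have h20 : 0 <= h *+ 2 by rewrite mulrn_wge0.
have mono (u : R) i m : (i < m)%N -> u + h *+ 2 *+ i + h + h <= u + h *+ 2 *+ m.
  move=> im; rewrite -grid_succ.
  by rewrite lerD2l ler_wpMn2l.
have posu (u : R) i : u <= u + h *+ 2 *+ i by rewrite lerDl mulrn_wge0.
rewrite (Rintegral_mul_pulse_train g G)//; last first.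
  by move=> i im; have := mono u1 i m1 im; have := posu u1 i; lra.
rewrite (Rintegral_mul_pulse_train g G)//; last first.
  by move=> i im; have := mono u2 i m2 im; have := posu u2 i; lra.
congr (_ + _); rewrite mulN1r -sumrN; apply: eq_bigr => i _.
rewrite /=; set v := u2 + h *+ 2 *+ i.
have -> : - (v + h + h) + h = - (v + h) by ring.
have -> : - (v + h) + h = - v by ring.
ring.
Qed.

End test_function.

(** * The deviation *)

Section deviation.
Context {R : realType}.
Notation mu := (@lebesgue_measure R).
Notation D := [set` `[- (pi : R), pi]].
Variables (alpha r beta : R) (n : nat).
Notation psi := (fun k : nat => coef alpha r k%:R).
Notation d := (alpha * r / n%:R `^ (1 - r)).
Notation b := (beta * pi / 2).
Notation A := (coef alpha r n%:R).

Lemma reflected_antiderivative (q F : R -> R) :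
  (forall x : R, is_derive x 1 F (q x)) ->
  forall x : R, is_derive x 1 (fun t => - F (- t)) (q (- x)).
Proof.
move=> dF x; have := is_deriveN (@is_derive1_comp _ F (- id) x _ _ (dF (- x))
  (is_deriveN (is_derive_id x (1 : R)))).
by rewrite mulrN1 opprK.
Qed.

(** The two half-lines together give 4 / pi times the logarithm plus 122; the factor 1 / pi of the
    convolution turns this into 4 / pi^2 and at most 61, as pi >= 2. *)
Lemma deviation_upper (alpha0 : 0 < alpha) (r0 : 0 < r) (r1 : r < 1) (n0 : (0 < n)%N) :
  d <= 216^-1 -> 216 <= alpha * r * n%:R `^ r ->
  (fourier_deviation alpha r beta n <=
    (A * (4 / pi ^+ 2 * ln (pi / d) + 61))%:E)%E.
Proof.
move=> d1 nd.
have B := tail_sum_le _ _ _ alpha0 r0 r1 n0 d1 nd.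
have ok c := tail_oscillating _ _ _ alpha0 r0 r1 n0 c d1 nd.
have psi0 k : 0 <= psi k by exact/ltW/coef_gt0.
have A0 : 0 < A by exact: coef_gt0.
have cq : continuous (fun t => `|cos_tail psi b n t|).
  by move=> t; apply: cvg_norm; exact: (continuous_cos_tail psi b n _ psi0 B).
have [G dG] := exists_antiderivative _ cq.
have G1 := half_line_upper _ _ _ _ _ _ _ (ok b) dG.
have dG' (x : R) : is_derive x 1 (fun t => - G (- t)) `|cos_tail psi (- b) n x|.
  by rewrite -cos_tailN; exact: (reflected_antiderivative (fun t => `|cos_tail psi b n t|)).
have G2 := half_line_upper _ _ _ _ _ _ _ (ok (- b)) dG'.
have {G1 G2} GG : G pi - G (- pi) <= A * (4 / pi * ln (pi / d) + 122).
  move: G1 G2; rewrite oppr0; set L := ln _; set p := pi.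
  have -> : 4 / p * L = 2 / p * L + 2 / p * L by ring.
  by clear; lra.
apply: ge_ereal_sup => _ [f [_ [a0 [phi [[mphi _ _] phi1 _] fE]]] <-].
apply: ge_ereal_sup => _ [x _ <-]; rewrite lee_fin.
have phiae : {ae mu, forall t, `|phi t| <= 1}.
  move/ess_supP : phi1; apply: filterS => t.
  by rewrite lee_fin.
have [phi' [mphi' phi'1 phi'E]] := ae_clamp (- pi) pi phi mphi phiae.
have fE' y : f y = a0 / 2 + pi^-1 * \int[mu]_(t in D) (cos_series psi b (y - t) * phi' t).
  rewrite fE; congr (_ + _ * _); apply: (phi'E (fun t => cos_series psi b (y - t))).
  exact/continuous_reflect/(continuous_cos_series psi b n _ psi0 B).
rewrite (remainder_formula _ _ _ _ _ _ _ n0 psi0 B mphi' phi'1 fE').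
have H := remainder_norm_le psi b n _ phi' G n0 psi0 B mphi' phi'1 dG x.
have p0 := pi_gt0 R; have p2 := pi_ge2 R.
rewrite normrM gtr0_norm ?invr_gt0// ler_pdivrMl//.
apply: (le_trans H); apply: (le_trans GG).
rewrite mulrCA ler_pM2l//; move: (ln _) => L.
set p := pi in p0 p2 *; clearbody p.
have -> : p * (4 / p ^+ 2 * L + 61) = 4 / p * L + 61 * p.
  by field; rewrite gt_eqF.
by rewrite lerD2l; lra.
Qed.

Lemma poisson_class_convolution (phi : R -> R) :
  measurable_fun [set: R] phi -> periodic phi (pi *+ 2) ->
  (forall t, `|phi t| <= 1) -> \int[mu]_(t in D) phi t = 0 ->
  poisson_class alpha r beta
    (fun x => 0 / 2 + pi^-1 * \int[mu]_(t in D) (cos_series psi b (x - t) * phi t)).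
Proof.
move=> mphi perphi phi1 phi0.
have phiess : (ess_sup mu (fun t : R => `|phi t|%:E) <= 1)%E.
  by apply: (@ess_sup_ler _ _ _ mu (fun t => `|phi t|)) => t; rewrite lee_fin.
split.
  move=> x; congr (_ + _ * _); apply: eq_Rintegral => t _; congr (_ * _).
  have := cos_tail_periodic psi b 1 (x - t).
  by rewrite /cos_tail /cos_sum !big_geq// !subr0 addrAC.
exists 0, phi => //; split => //; split => //.
exact: le_lt_trans phiess (ltry _).
Qed.

(** The deviation is tested at 0, where the kernel is q(-t), the tail of phase [- b]. Hence [F] is
    taken for [- b], and its reflection serves phase [b] on the other half-line. The two losses of
    20, divided by pi, stay below 20. *)
Lemma deviation_lower (alpha0 : 0 < alpha) (r0 : 0 < r) (r1 : r < 1) (n0 : (0 < n)%N) :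
  d <= 216^-1 -> 216 <= alpha * r * n%:R `^ r ->
  ((A * (4 / pi ^+ 2 * ln (pi / d) - 20))%:E <=
    fourier_deviation alpha r beta n)%E.
Proof.
move=> d1 nd.
have B := tail_sum_le _ _ _ alpha0 r0 r1 n0 d1 nd.
have ok c := tail_oscillating _ _ _ alpha0 r0 r1 n0 c d1 nd.
have psi0 k : 0 <= psi k by exact/ltW/coef_gt0.
have A0 : 0 < A by exact: coef_gt0.
have cq := continuous_cos_tail psi (- b) n _ psi0 B.
have [F dF] := exists_antiderivative _ cq.
have [u1 [m1 [u10 u1pi S1]]] := half_line_lower _ _ _ _ _ _ _ (ok (- b)) dF.
have dF' (x : R) : is_derive x 1 (fun t => - F (- t)) (cos_tail psi b n x).
  by rewrite -[b]opprK -cos_tailN; exact: reflected_antiderivative.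
have [u2 [m2 [u20 u2pi S2]]] := half_line_lower _ _ _ _ _ _ _ (ok b) dF'.
have [_ _ _ h0 _ _ _ _] := ok b.
have [phi [mphi perphi phi1 phiE]] :=
  exists_test_function u1 u2 _ m1 m2 h0 u10 u1pi u20 u2pi.
(* The integration formula of the test function for the constant 1 with antiderivative [id]: the two
   halves of each period cancel. *)
have phi0 : \int[mu]_(t in D) phi t = 0.
  transitivity (\int[mu]_(t in D) (1 * phi t)).
    by apply: eq_Rintegral => t _; rewrite mul1r.
  rewrite (phiE (cst 1) id); last by move=> t; exact: cvg_cst.
  rewrite !big1 ?addr0// => i _ /=; ring.
have Pf := poisson_class_convolution phi mphi perphi phi1 phi0.
set f := (fun x : R => _) in Pf.
have p0 := pi_gt0 R; have p2 := pi_ge2 R.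
apply: (@le_trans _ _ (normC (fun x => f x - fourier_sum f n.-1 x))); last first.
  by apply: ereal_sup_ubound; exists f.
apply: (@le_trans _ _ (`|f 0 - fourier_sum f n.-1 0|)%:E); last first.
  by apply: ereal_sup_ubound; exists 0.
rewrite lee_fin (remainder_formula psi b n _ phi 0 f n0 psi0 B mphi phi1)//.
apply: le_trans (ler_norm _).
rewrite ler_pdivlMl//.
have -> : \int[mu]_(t in D) (cos_tail psi b n (0 - t) * phi t) =
    \int[mu]_(t in D) (cos_tail psi (- b) n t * phi t).
  by apply: eq_Rintegral => t _; rewrite sub0r cos_tailN.
rewrite (phiE _ _ cq dF); apply: le_trans (lerD S1 S2).
rewrite mulrCA -mulrDr ler_pM2l//; move: (ln _) => L.
set p := pi in p0 p2 *; clearbody p.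
have -> : p * (4 / p ^+ 2 * L - 20) = 2 / p * L + 2 / p * L - 20 * p.
  by field; rewrite gt_eqF.
by lra.
Qed.

End deviation.

Theorem theorem3 (R : realType) (alpha r beta : R)
    (alpha_gt0 : 0 < alpha) (r01 : 0 < r < 1) (n : nat)
    (n1_le_n : (n1 alpha_gt0 r01 <= n)%N) :
  exists gamma : R,
    `|gamma| <= 20 * pi ^+ 4 /\
    fourier_deviation alpha r beta n =
      (4 / pi ^+ 2 * expR (- alpha * n%:R `^ r)
         * ln (pi * n%:R `^ (1 - r) / (alpha * r))
       + gamma * expR (- alpha * n%:R `^ r))%:E.
Proof.
have [n0 d1 nd] := n1_bounds _ _ _ _ _ n1_le_n.
have /andP[r0 r1] := r01.
have lo := deviation_lower alpha r beta n alpha_gt0 r0 r1 n0 d1 nd.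
have up := deviation_upper alpha r beta n alpha_gt0 r0 r1 n0 d1 nd.
have A0 : 0 < coef alpha r n%:R by exact: coef_gt0.
have dE : pi / (alpha * r / n%:R `^ (1 - r)) = pi * n%:R `^ (1 - r) / (alpha * r).
  by rewrite invf_div mulrA.
rewrite dE in lo up.
rewrite -/(coef alpha r n%:R).
(* The two bounds exclude infinite values, so the deviation is a real number [v]. *)
move: (fourier_deviation alpha r beta n) lo up => [v|//|//].
rewrite !lee_fin; move: (ln _) (coef _ _ _) A0 => L A A0 lo up.
exists (v / A - 4 / pi ^+ 2 * L); split; last first.
  by congr (_%:E); rewrite mulrBl divfK ?gt_eqF//; ring.
have p2 := pi_ge2 R.
(* The witness lies between -20 and 61, and 320 = 20 * 2^4 is at most 20 pi^4. *)
apply: (@le_trans _ _ 320).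
  rewrite ler_norml; apply/andP; split.
    by rewrite lerBrDr; apply: (@le_trans _ _ (4 / pi ^+ 2 * L - 20)); [lra|rewrite ler_pdivlMr// mulrC].
  by rewrite lerBlDr; apply: (@le_trans _ _ (4 / pi ^+ 2 * L + 61)); [rewrite ler_pdivrMr// mulrC|lra].
have p4 : 2 ^+ 4 <= pi ^+ 4 :> R by rewrite lerXn2r ?nnegrE//; lra.
by rewrite (_ : 320 = 20 * 2 ^+ 4); [rewrite ler_pM2l|ring].
Qed.
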